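(* Let $W_{\sf cantor}\subset(0,1)^2$ be the common boundary, in the open unit square, of the three lakes of Wada constructed in the standard Cantor way. Then the Minkowski dimension of $W_{\sf cantor}$ exists and $$\dim_{\sf box}(W_{\sf cantor})=\frac{\ln(6)}{\ln(3)}.$$
   Context: **Minkowski dimension.** For a bounded set $S\subset\mathbb{R}^n$ and $\epsilon>0$ let $N(\epsilon)$ be the (minimal) number of boxes (cubes; squares if $n=2$) of side length $\epsilon$ required to cover $S$. The upper and lower Minkowski dimensions of $S$ are the $\limsup$ and $\liminf$ of $\ln(N(\epsilon))/\ln(1/\epsilon)$ as $\epsilon\to0^+$; when they agree, the common value is the Minkowski dimension $\dim_{\sf box}(S)$. **Lakes of Wada in the standard Cantor way.** Put $t_n=3^{-n}$ for $n\ge 0$ and $w_n=3^{-n}$ for $n\ge1$. One constructs closed canals $C_1,C_2,\dots\subset[0,1]^2$ (with $C_n$ dug on Day $n$); the island after Day $n$ is $I_n:=\overline{[0,1]^2\setminus(C_1\cup\dots\cup C_n)}$, with $I_0=[0,1]^2$. For every $n\ge1$, $I_n$ is a rectilinear strip of constant width $t_n$: a finite chain of axis-parallel straight pieces of width $t_n$ joined at right angles by $t_n\times t_n$ corner squares, having two end edges of length $t_n$ and two long sides. The canals have width $w_n$ and are as follows. - Day 1: $C_1=[0,\frac23]\times[\frac13,\frac23]$. The two end edges of $I_1$ lie on the left side $\{x=0\}$ of the square. - Days $n=2,3$: $C_n$ enters $I_{n-1}$ from the left side $\{x=0\}$ through one of the two end edges of $I_{n-1}$ (the lower one if $n=2$;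 either one if $n=3$), runs along the middle of the whole strip, leaving land of width $t_n$ on both sides, and stops at distance $t_n$ from the other end edge. - Days $n\ge4$: a peak point of a canal is the midpoint of an edge (of length equal to the width of the canal) in which the canal terminates; $C_1,C_2,C_3$ have one peak point each (that of $C_1$ is $(\frac23,\frac12)$), and each $C_n$ with $n\ge4$ has two. Choose one peak point $p$ of $C_{n-3}$; it lies on a long side of the strip $I_{n-1}$. The canal $C_n$ starts at $p$, crosses the wall of the strip perpendicularly (by a connecting piece of width $w_n$ with axis through $p$) to the middle of the strip, separates there into two opposite directions, and runs in both directions along the middle of the strip, leaving land of width $t_n$ on both sides, until it stops at distance $t_n$ from each of the two end edges of $I_{n-1}$. (After Day $n$ every point of the island is at distance at most $\sqrt2\,t_n$ from the lake extended on Day $n$.) The lakes $B_{3k+1}$, $R_{3k+2}$, $G_{3k+3}$ ($k\ge0$) are the interiors of $\bigcup_{j=0}^kC_{3j+1}$, $\bigcup_{j=0}^kC_{3j+2}$, $\bigcup_{j=0}^kC_{3j+3}$ respectively. Let $U_B=\bigcup_kB_{3k+1}$, $U_R=\bigcup_kR_{3k+2}$, $U_G=\bigcup_kG_{3k+3}$. These have the same boundary in $(0,1)^2$, and $$W_{\sf cantor}:=(0,1)^2\cap\partial U_B=(0,1)^2\cap\partial U_R=(0,1)^2\cap\partial U_G.$$ *)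

(* Defs.v *)
From HB Require Import structures.
From mathcomp Require Import all_boot all_order all_algebra.
From mathcomp Require Import all_classical all_reals all_analysis.
Set Implicit Arguments.
Unset Strict Implicit.
Unset Printing Implicit Defensive.
Import Order.TTheory GRing.Theory Num.Theory.
Import numFieldNormedType.Exports.
Local Open Scope classical_set_scope.
Local Open Scope ring_scope.

(** * Minkowski dimension of plane sets *)

Definition box (R : realType) (c : R * R) (e : R) : set (R * R) :=
  [set z | c.1 <= z.1 <= c.1 + e /\ c.2 <= z.2 <= c.2 + e].

Definition coverable (R : realType) (S : set (R * R)) (e : R) (k : nat) : Prop :=
  exists c : 'I_k -> R * R, S `<=` \bigcup_(i in [set: 'I_k]) box (c i) e.

(* The value is 0 when no finite cover exists, which does not happen for
   bounded [S] and [0 < e]. *)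
Definition covering_number (R : realType) (S : set (R * R)) (e : R) : nat :=
  xget 0%N [set k | coverable S e k /\
                    forall m, coverable S e m -> (k <= m)%N].

Definition box_ratio (R : realType) (S : set (R * R)) (e : R) : \bar R :=
  (ln ((covering_number S e)%:R : R) / ln (1 / e))%:E.

Definition upper_box_dim (R : realType) (S : set (R * R)) : \bar R :=
  limf_esup (box_ratio S) 0^'+.

Definition lower_box_dim (R : realType) (S : set (R * R)) : \bar R :=
  limf_einf (box_ratio S) 0^'+.

Definition has_box_dim (R : realType) (S : set (R * R)) (d : R) : Prop :=
  upper_box_dim S = d%:E /\ lower_box_dim S = d%:E.

(** * Rectilinear strips

   A strip of width [w] is given by its axis (centre line): the list of the
   vertices of an axis-parallel polygonal line, whose first and last points are
   the midpoints of the two end edges and whose other points are the centres of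
   the corner squares. The norm on [R * R] is the sup norm; on axis-parallel
   segments it gives the Euclidean length. *)

(* Rectangle of width [w] around the axis-parallel segment [a b], ending flush
   at [a] and at [b]; for [w = 0] it is the segment itself. *)
Definition band (R : realType) (w : R) (a b : R * R) : set (R * R) :=
  [set z | (a.2 = b.2 /\ Num.min a.1 b.1 <= z.1 <= Num.max a.1 b.1 /\
            `|z.2 - a.2| <= w / 2) \/
           (a.1 = b.1 /\ Num.min a.2 b.2 <= z.2 <= Num.max a.2 b.2 /\
            `|z.1 - a.1| <= w / 2)].

Definition square (R : realType) (w : R) (c : R * R) : set (R * R) :=
  [set z | `|z.1 - c.1| <= w / 2 /\ `|z.2 - c.2| <= w / 2].

Definition corner (R : realType) (s : seq (R * R)) (i : nat) : bool :=
  (0 < i < (size s).-1)%N.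

(* The [i]-th straight piece together with the corner squares at its ends. *)
Definition piece (R : realType) (w : R) (s : seq (R * R)) (i : nat) : set (R * R) :=
  band w s`_i s`_i.+1
  `|` [set z | corner s i /\ square w s`_i z]
  `|` [set z | corner s i.+1 /\ square w s`_i.+1 z].

Definition strip (R : realType) (w : R) (s : seq (R * R)) : set (R * R) :=
  \bigcup_(i in [set i | (i.+1 < size s)%N]) piece w s i.

Definition horizontal (R : realType) (a b : R * R) : bool := a.2 == b.2.
Definition vertical (R : realType) (a b : R * R) : bool := a.1 == b.1.

(* The third condition says that the straight pieces have positive length once
   the halves of the adjacent corner squares are removed. *)
Definition strip_axis (R : realType) (w : R) (s : seq (R * R)) : Prop :=
  [/\ (1 < size s)%N,
      forall i, (i.+1 < size s)%N ->
        horizontal s`_i s`_i.+1 || vertical s`_i s`_i.+1,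
      forall i, (i.+1 < size s)%N ->
        (corner s i)%:R * (w / 2) + (corner s i.+1)%:R * (w / 2)
          < `|s`_i.+1 - s`_i|,
      forall i, (i.+2 < size s)%N ->
        horizontal s`_i s`_i.+1 = vertical s`_i.+1 s`_i.+2
    & forall i j, (i.+1 < j)%N -> (j.+1 < size s)%N ->
        piece w s i `&` piece w s j = set0].

(* Shorten an axis by [d] at its first end, resp. at its last end. *)
Definition trim_head (R : realType) (d : R) (s : seq (R * R)) : seq (R * R) :=
  if s is a :: b :: s' then
    (a.1 + d * ((b.1 - a.1) / `|b - a|), a.2 + d * ((b.2 - a.2) / `|b - a|))
      :: b :: s'
  else s.

Definition trim_last (R : realType) (d : R) (s : seq (R * R)) : seq (R * R) :=
  rev (trim_head d (rev s)).

(* [p] lies on a long side of the strip of width [w] and axis [s], and [q] is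
   the point of the axis reached by crossing perpendicularly from [p]. *)
Definition foot (R : realType) (w : R) (s : seq (R * R)) (p q : R * R) : Prop :=
  exists i, [/\ (i.+1 < size s)%N, band 0 s`_i s`_i.+1 q &
    (horizontal s`_i s`_i.+1 /\ p.1 = q.1 /\ `|p.2 - q.2| = w / 2) \/
    (vertical s`_i s`_i.+1 /\ p.2 = q.2 /\ `|p.1 - q.1| = w / 2)].

(** * Canals

   [C n] is the canal dug on day [n >= 1] ([C 0] is not used) and [A n] is the
   axis of the island [I_n], [n >= 1]. *)

Definition land_width (R : realType) (n : nat) : R := 3 ^- n.
Definition canal_width (R : realType) (n : nat) : R := 3 ^- n.

Definition unit_square (R : realType) : set (R * R) :=
  [set z | 0 <= z.1 <= 1 /\ 0 <= z.2 <= 1].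

Definition open_unit_square (R : realType) : set (R * R) :=
  [set z | 0 < z.1 < 1 /\ 0 < z.2 < 1].

Definition island (R : realType) (C : nat -> set (R * R)) (n : nat) : set (R * R) :=
  closure (@unit_square R `\` \bigcup_(m in [set m | (1 <= m <= n)%N]) C m).

(* Axis of the part of the [n]-th canal running along the middle of [I_(n-1)];
   for [n = 2, 3] the canal enters through the first end of the strip. *)
Definition canal_axis (R : realType) (A : nat -> seq (R * R)) (n : nat) : seq (R * R) :=
  let s := trim_last (land_width R n) (A n.-1) in
  if (n <= 3)%N then s else trim_head (land_width R n) s.

(* The canal terminates at the ends of its axis, so its peak points are the
   endpoints of the axis, except the one where it enters for [n = 2, 3]. *)
Definition peak (R : realType) (A : nat -> seq (R * R)) (n : nat) (p : R * R) : Prop :=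
  if n == 1%N then p = (2 / 3, 1 / 2)
  else let s := canal_axis A n in
       p = last 0 s \/ ((3 < n)%N /\ p = head 0 s).

Definition cantor_canals (R : realType)
    (C : nat -> set (R * R)) (A : nat -> seq (R * R)) : Prop :=
  [/\ C 1%N = [set z | 0 <= z.1 <= 2 / 3 /\ 1 / 3 <= z.2 <= 2 / 3],
      forall n, (1 <= n)%N ->
        strip_axis (land_width R n) (A n) /\
        island C n = strip (land_width R n) (A n),
      (* [(0, 1/6)] is the midpoint of the lower end edge of [I_1] *)
      head 0 (A 1%N) = (0, 1 / 6) /\ (head 0 (A 2%N)).1 = 0,
      forall n, (2 <= n <= 3)%N ->
        C n = strip (canal_width R n) (canal_axis A n)
    & forall n, (4 <= n)%N -> exists p q : R * R,
        [/\ peak A (n - 3) p, foot (land_width R n.-1) (A n.-1) p q &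
            C n = strip (canal_width R n) (canal_axis A n)
                  `|` band (canal_width R n) p q]].

(** * Lakes *)

(* The [k]-th stage of the lake of colour [c], where [c = 1, 2, 3] stands for
   blue, red, green: [B_(3k+1)], [R_(3k+2)], [G_(3k+3)]. *)
Definition lake_stage (R : realType) (C : nat -> set (R * R)) (c k : nat) : set (R * R) :=
  interior (\bigcup_(j in [set j | (j <= k)%N]) C (3 * j + c)%N).

Definition lake (R : realType) (C : nat -> set (R * R)) (c : nat) : set (R * R) :=
  \bigcup_k lake_stage C c k.

Definition frontier (T : topologicalType) (S : set T) : set T :=
  closure S `\` interior S.

Definition shore (R : realType) (C : nat -> set (R * R)) (c : nat) : set (R * R) :=
  @open_unit_square R `&` frontier (lake C c).

(* Main.v *)
(* Write t_n = 3^-n and let L_n be the length of the axis of the strip I_n. Since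
   the corner squares can be attached to the straight pieces, I_n has area exactly
   t_n L_n. Digging the canal C_(n+1), of width t_(n+1) = t_n / 3, removes about a
   third of this area, so L_(n+1) = 2 L_n + O(t_(n+1)) and L_n is of order 2^n.

   Canals of different colours are disjoint in the open square: C_n runs in the
   interior of I_(n-1), except for the edge of its connecting band on the peak p of
   C_(n-3). One shows by induction that just in front of the edge of C_(n-3) through
   p there is only land of I_(n-1) and just behind it none; as I_(n-1) is only a
   quarter neighbourhood of a corner of its end edges, p is far from those, so that
   the band stays in I_(n-1) and does not come close to the tips of C_n. Hence the
   three shores are the intersection of the open square with all the islands.

   I_n is covered by at most 5 L_n / t_n boxes of side t_n. Conversely every point of
   I_n is within 3 t_n of the shore, because C_(n+1) and C_(n+2) pass nearby, so
   comparing areas shows that order of L_n / t_n, that is 6^n, boxes are needed. *)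

Require Import Defs.
From HB Require Import structures.
From mathcomp Require Import all_boot all_order all_algebra.
From mathcomp Require Import all_classical all_reals all_analysis.
From mathcomp Require Import ring lra zify.
Set Implicit Arguments.
Unset Strict Implicit.
Unset Printing Implicit Defensive.
Import Order.TTheory GRing.Theory Num.Theory.
Import numFieldNormedType.Exports.
Local Open Scope classical_set_scope.
Local Open Scope ring_scope.

(** * Axis-parallel frames in the plane *)

Section Plane.
Context {R : realType}.
Implicit Types (a b u z y : R * R) (S : set (R * R)).

(** [cantor_canals] only says that each island is the strip of some axis: no clause describes the
    list [A n.+1] in terms of [A n], so lengths are compared through areas and never by following
    the turns. The comparison needs the trimmed axis of a canal to be a genuine strip axis, and for
    this the axis of the island must have a corner: with three vertices or more, every segment is
    longer than one and a half canal widths and is trimmed at one end at most. The corner comes from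
    the length itself, since a straight axis inside the unit square has length at most 1; hence the
    lower bound of the lengths and the existence of corners are carried by one induction. A second
    obstacle is that [foot] lets a peak lie over any point of a segment, ends and corners included,
    and on either side. Its position is determined only by the way land lies around it. Facts about
    one end of a strip reach the other end by reversing the axis, and the geometry is done in the
    frame of a segment, where it reduces to linear inequalities. *)

Definition nbd z (r : R) : set (R * R) :=
  [set y | - r < y.1 - z.1 < r /\ - r < y.2 - z.2 < r].

(** The interior, in terms of the sup-norm squares [nbd], whose linear inequalities are directly
    usable by [lra]. *)
Definition mint S : set (R * R) := [set z | exists2 r, 0 < r & nbd z r `<=` S].

Lemma nbd_id z (r : R) : 0 < r -> nbd z r z.
Proof. by move=> r0; split => /=; lra. Qed.

Lemma interior_mint S : interior S = mint S.
Proof.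
apply/seteqP; split => z /=.
  move=> /nbhs_ballP[r /= r0 h]; exists r => // y [y1 y2].
  apply: h; split => /=; rewrite /ball /= ltr_norml; lra.
move=> [r r0 h]; apply/nbhs_ballP; exists r => // y [].
rewrite /ball /= !ltr_norml => y1 y2; apply: h; split; lra.
Qed.

Lemma closureP S z :
  closure S z <-> forall r, 0 < r -> exists2 y, nbd z r y & S y.
Proof.
split=> [h r r0|h B /nbhs_ballP[r /= r0 hB]].
  have /h[y [Sy zy]] : nbhs z (nbd z r).
    suff : interior (nbd z r) z by [].
    by rewrite interior_mint; exists r.
  by exists y.
have [y [y1 y2] Sy] := h _ r0; exists y; split => //.
apply: hB; split; rewrite /ball /= ltr_norml; lra.
Qed.

Lemma mint_sub S : mint S `<=` S.
Proof. by move=> z [r r0]; apply; exact: nbd_id. Qed.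

Lemma mintS S S' : S `<=` S' -> mint S `<=` mint S'.
Proof. by move=> h z [r r0 hr]; exists r => // y /hr/h. Qed.

Lemma nbdS z (r r' : R) : r <= r' -> nbd z r `<=` nbd z r'.
Proof. by move=> rr y [y1 y2]; split; lra. Qed.

Lemma mint_open S z : mint S z -> exists2 r, 0 < r & nbd z r `<=` mint S.
Proof.
move=> [r r0 h]; exists (r / 2); first by lra.
move=> y [y1 y2]; exists (r / 2); first by lra.
by move=> x [x1 x2]; apply: h; split; lra.
Qed.

(** The four axis directions. In the frame with origin [a] and first vector [u], the second vector
    being [u] turned counterclockwise by a quarter, [along] and [across] are the coordinates and
    [pt] is the inverse map. *)
Definition unitv u := u = (1, 0) \/ u = (-1, 0) \/ u = (0, 1) \/ u = (0, -1).

Definition along a u z : R := (z.1 - a.1) * u.1 + (z.2 - a.2) * u.2.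
Definition across a u z : R := (z.2 - a.2) * u.1 - (z.1 - a.1) * u.2.
Definition pt a u (x y : R) : R * R :=
  (a.1 + x * u.1 - y * u.2, a.2 + x * u.2 + y * u.1).

Lemma along_pt a u (x y : R) : unitv u -> along a u (pt a u x y) = x.
Proof. by rewrite /along /pt => -[->|[->|[->|->]]] /=; lra. Qed.

Lemma across_pt a u (x y : R) : unitv u -> across a u (pt a u x y) = y.
Proof. by rewrite /across /pt => -[->|[->|[->|->]]] /=; lra. Qed.

Lemma along_shift a u (x y : R) z : unitv u ->
  along (pt a u x y) u z = along a u z - x.
Proof. by rewrite /along /pt => -[->|[->|[->|->]]] /=; lra. Qed.

Lemma across_shift a u (x y : R) z : unitv u ->
  across (pt a u x y) u z = across a u z - y.
Proof. by rewrite /across /pt => -[->|[->|[->|->]]] /=; lra. Qed.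

Lemma pt_pt a u (x y x' y' : R) : pt (pt a u x y) u x' y' = pt a u (x + x') (y + y').
Proof. by rewrite /pt /=; congr (_, _); lra. Qed.

Lemma pt_along a u z : unitv u -> pt a u (along a u z) (across a u z) = z.
Proof.
case: z => z1 z2.
by rewrite /along /across /pt => -[->|[->|[->|->]]] /=; congr (_, _); lra.
Qed.

(** Quarter turns preserve sup-norm squares, so these look the same in every frame. *)
Lemma nbdE a u z y (r : R) : unitv u -> nbd z r y <->
  - r < along a u y - along a u z < r /\ - r < across a u y - across a u z < r.
Proof.
rewrite /nbd /along /across => -[->|[->|[->|->]]] /=; split=> -[h1 h2]; split; lra.
Qed.

Arguments nbdE a {u z y r}.

Definition frect a u (x1 x2 y1 y2 : R) : set (R * R) :=
  [set z | x1 <= along a u z <= x2 /\ y1 <= across a u z <= y2].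
Definition ofrect a u (x1 x2 y1 y2 : R) : set (R * R) :=
  [set z | x1 < along a u z < x2 /\ y1 < across a u z < y2].

Lemma ofrect_sub a u (x1 x2 y1 y2 : R) : ofrect a u x1 x2 y1 y2 `<=` frect a u x1 x2 y1 y2.
Proof. by move=> z [h1 h2]; split; lra. Qed.

Lemma ofrect_int a u (x1 x2 y1 y2 : R) : unitv u ->
  ofrect a u x1 x2 y1 y2 `<=` mint (ofrect a u x1 x2 y1 y2).
Proof.
move=> hu z [/andP[h1 h2] /andP[h3 h4]].
exists (Num.min (Num.min (along a u z - x1) (x2 - along a u z))
  (Num.min (across a u z - y1) (y2 - across a u z))).
  by rewrite !lt_min !subr_gt0 h1 h2 h3 h4.
move=> y /(nbdE a hu).
set r := Num.min _ _ => -[k1 k2].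
have r1 : r <= along a u z - x1 by rewrite !ge_min lexx.
have r2 : r <= x2 - along a u z by rewrite !ge_min lexx orbT.
have r3 : r <= across a u z - y1 by rewrite !ge_min lexx orbT.
have r4 : r <= y2 - across a u z by rewrite !ge_min lexx !orbT.
by split; lra.
Qed.

Lemma approx_inside (x1 x2 x r : R) : x1 < x2 -> x1 <= x <= x2 -> 0 < r ->
  exists2 x', - r < x' - x < r & x1 < x' < x2.
Proof.
move=> x12 hx r0.
have [h|h] := lerP (x1 + x2) (2 * x).
  have [k|k] := lerP r (x2 - x1); [exists (x - r / 4)|exists (x - (x2 - x1) / 4)]; lra.
have [k|k] := lerP r (x2 - x1); [exists (x + r / 4)|exists (x + (x2 - x1) / 4)]; lra.
Qed.

Lemma frect_approx a u (x1 x2 y1 y2 : R) z (r : R) : unitv u -> x1 < x2 -> y1 < y2 ->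
  frect a u x1 x2 y1 y2 z -> 0 < r ->
  exists2 y, nbd z r y & ofrect a u x1 x2 y1 y2 y.
Proof.
move=> hu hx hy [h1 h2] r0.
have [x' x'1 x'2] := approx_inside hx h1 r0.
have [y' y'1 y'2] := approx_inside hy h2 r0.
exists (pt a u x' y').
  by apply/(nbdE a hu); rewrite along_pt // across_pt.
by split; rewrite ?along_pt ?across_pt.
Qed.

(* Both properties hold for finite unions of nondegenerate closed rectangles. *)
Definition mint_dense S := forall z r, S z -> 0 < r -> exists2 y, nbd z r y & mint S y.
Definition co_open S := forall z, ~ S z -> exists2 r, 0 < r & forall y, nbd z r y -> ~ S y.

Lemma frect_co_open a u (x1 x2 y1 y2 : R) : unitv u -> co_open (frect a u x1 x2 y1 y2).
Proof.
move=> hu z hz.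
have [h|h1] := ltP (along a u z) x1.
  exists (x1 - along a u z); first by lra.
  by move=> y /(nbdE a hu)[k _] [k' _]; lra.
have [h|h2] := ltP x2 (along a u z).
  exists (along a u z - x2); first by lra.
  by move=> y /(nbdE a hu)[k _] [k' _]; lra.
have [h|h3] := ltP (across a u z) y1.
  exists (y1 - across a u z); first by lra.
  by move=> y /(nbdE a hu)[_ k] [_ k']; lra.
have [h|h4] := ltP y2 (across a u z).
  exists (across a u z - y2); first by lra.
  by move=> y /(nbdE a hu)[_ k] [_ k']; lra.
by exfalso; apply: hz; split; apply/andP.
Qed.

Lemma frect_mint_dense a u (x1 x2 y1 y2 : R) : unitv u -> x1 < x2 -> y1 < y2 ->
  mint_dense (frect a u x1 x2 y1 y2).
Proof.
move=> hu hx hy z r hz r0; have [y zy hy'] := frect_approx hu hx hy hz r0.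
exists y => //; apply: mintS (ofrect_int hu hy'); exact: ofrect_sub.
Qed.

Lemma mint_denseU S S' : mint_dense S -> mint_dense S' -> mint_dense (S `|` S').
Proof.
move=> h h' z r [/h k|/h' k] /k [y zy yS]; exists y => //; apply: mintS yS => x; by [left|right].
Qed.

Lemma co_openU S S' : co_open S -> co_open S' -> co_open (S `|` S').
Proof.
move=> h h' z /not_orP[/h[r r0 k] /h'[r' r0' k']].
exists (Num.min r r'); first by rewrite lt_min r0.
by move=> y zy [/k|/k']; apply; apply: nbdS zy; rewrite ge_min lexx ?orbT.
Qed.

Lemma mint_dense_bigcup (I : Type) (D : set I) (F : I -> set (R * R)) :
  (forall i, D i -> mint_dense (F i)) -> mint_dense (\bigcup_(i in D) F i).
Proof.
move=> h z r [i Di Fz] r0; have [y zy Fy] := h i Di z r Fz r0.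
by exists y => //; apply: mintS Fy => x; exists i.
Qed.

(** Finiteness is a bound on the indices, so that [D] can be cut out by a predicate, as for the
    cells other than the first or the canals of other colours. *)
Lemma co_open_bigcup (D : set nat) (F : nat -> set (R * R)) n :
  (forall i, D i -> (i <= n)%N) -> (forall i, D i -> co_open (F i)) ->
  co_open (\bigcup_(i in D) F i).
Proof.
elim: n D => [|n IH] D hn h z nz.
  have [D0|nD] := pselect (D 0%N).
    have /(h _ D0)[r r0 k] : ~ F 0%N z by move=> Fz; apply: nz; exists 0%N.
    exists r => // y /k ky [i Di]; have := hn i Di; rewrite leqn0 => /eqP ->; exact: ky.
  exists 1 => // y _ [i Di]; have := hn i Di; rewrite leqn0 => /eqP i0.
  by move: Di; rewrite i0.
pose D' := [set i | D i /\ (i <= n)%N].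
have [r r0 k] : exists2 r, 0 < r & forall y, nbd z r y -> ~ (\bigcup_(i in D') F i) y.
  apply: IH => [i []|i [/h]|] //.
  by move=> [i [Di _] Fz]; apply: nz; exists i.
have [Dn|nD] := pselect (D n.+1); last first.
  exists r => // y /k ky [i Di Fy]; apply: ky; exists i => //; split => //.
  by have := hn i Di; rewrite leq_eqVlt => /orP[/eqP i0|//]; move: Di; rewrite i0.
have /(h _ Dn)[r' r0' k'] : ~ F n.+1 z by move=> Fz; apply: nz; exists n.+1.
exists (Num.min r r'); first by rewrite lt_min r0.
move=> y zy [i Di]; have := hn i Di; rewrite leq_eqVlt => /orP[/eqP ->|i0 Fy].
  by apply: k'; apply: nbdS zy; rewrite ge_min lexx orbT.
apply: (k y); last by exists i.
by apply: nbdS zy; rewrite ge_min lexx.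
Qed.

End Plane.

Arguments nbdE {R} a {u z y r}.
(** * Strips as unions of rectangles *)

Section Segments.
Context {R : realType}.
Implicit Types (a b c u v z y : R * R) (s : seq (R * R)) (w t d l : R).

(** The same quotients as in [trim_head], so that trimming moves an end point along this vector. *)
Definition direction a b : R * R :=
  ((b.1 - a.1) / `|b - a|, (b.2 - a.2) / `|b - a|).

Lemma direction_unitv a b : horizontal a b || vertical a b -> 0 < `|b - a| ->
  unitv (direction a b) /\ b = pt a (direction a b) `|b - a| 0.
Proof.
case: a b => a1 a2 [b1 b2]; rewrite /horizontal /vertical /direction prod_normE /=.
case: (eqVneq a2 b2) => [->|_] /=.
  rewrite subrr normr0 => _; rewrite max_l // => h.
  have [b1a1|b1a1|e] := ltgtP 0 (b1 - a1).
  - rewrite gtr0_norm // divff ?gt_eqF // mul0r; split; first by left.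
    by rewrite /pt /=; congr (_, _); lra.
  - rewrite ltr0_norm // invrN mulrN divff ?lt_eqF // mul0r; split; first by right; left.
    by rewrite /pt /=; congr (_, _); lra.
  - by move: h; rewrite -e normr0 ltxx.
move=> /eqP ->; rewrite subrr normr0 max_r // => h.
have [b1a1|b1a1|e] := ltgtP 0 (b2 - a2).
- rewrite gtr0_norm // mul0r divff ?gt_eqF //; split; first by right; right; left.
  by rewrite /pt /=; congr (_, _); lra.
- rewrite ltr0_norm // mul0r invrN mulrN divff ?lt_eqF //; split; first by right; right; right.
  by rewrite /pt /=; congr (_, _); lra.
- by move: h; rewrite -e normr0 ltxx.
Qed.

Lemma directionC a b : direction b a = (- (direction a b).1, - (direction a b).2).
Proof. by rewrite /direction /= distrC -!mulNr !opprB. Qed.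

Lemma unitvN u : unitv u -> unitv (- u.1, - u.2).
Proof.
rewrite /unitv => -[->|[->|[->|->]]] /=; rewrite ?oppr0 ?opprK; tauto.
Qed.

Lemma bandE w a u l : unitv u -> 0 < l ->
  band w a (pt a u l 0) = frect a u 0 l (- (w / 2)) (w / 2).
Proof.
move=> hu l0; rewrite /band /frect /along /across /pt.
apply/seteqP; split => z /=; rewrite !ler_norml;
  move: hu => [->|[->|[->|->]]] /=;
  rewrite ?(mulr0, mul0r, mulr1, mul1r, addr0, subr0, add0r, mulN1r, mulrN1, mulrN);
  rewrite /Num.min /Num.max.
all: try (case: (ltrP _ _) => ?); try (case: (ltrP _ _) => ?).
all: move=> h; first [by exfalso; lra | by case: h => h; repeat split; lra
  | by left; repeat split; lra | by right; repeat split; lra].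
Qed.

Lemma squareE w c u : unitv u ->
  square w c = frect c u (- (w / 2)) (w / 2) (- (w / 2)) (w / 2).
Proof.
move=> hu; rewrite /square /frect /along /across.
apply/seteqP; split => z /=; rewrite !ler_norml;
  by move: hu => [->|[->|[->|->]]] /=; move=> h; split; lra.
Qed.

(** The lower bound on [l] prevents the corner square at one end from sticking out beyond an end
    edge at the other. *)
Lemma pieceE w s i u l : 0 <= w -> unitv u -> 0 < l ->
  (corner s i)%:R * (w / 2) + (corner s i.+1)%:R * (w / 2) <= l ->
  s`_i.+1 = pt s`_i u l 0 ->
  piece w s i = frect s`_i u (- ((corner s i)%:R * (w / 2)))
    (l + (corner s i.+1)%:R * (w / 2)) (- (w / 2)) (w / 2).
Proof.
move=> w0 hu l0 hl e; rewrite /piece e (bandE _ _ hu l0) !(squareE _ _ hu).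
apply/seteqP; split => z /=; rewrite /frect /= along_shift // across_shift // subr0.
  by case: (corner s i) hl; case: (corner s i.+1) => /= hl [[|[? ?]]|[? ?]] //; lra.
case: (corner s i) hl; case: (corner s i.+1) => /= hl [h1 h2].
- have [h|h] := ltrP (along s`_i u z) (w / 2); first by left; right; split => //; lra.
  have [k|k] := ltrP (along s`_i u z) l; first by left; left; lra.
  by right; split => //; lra.
- have [h|h] := ltrP (along s`_i u z) (w / 2); first by left; right; split => //; lra.
  by left; left; lra.
- have [k|k] := ltrP (along s`_i u z) l; first by left; left; lra.
  by right; split => //; lra.
- by left; left; lra.
Qed.

Definition udir s i : R * R := direction s`_i s`_i.+1.
Definition seglen s i : R := `|s`_i.+1 - s`_i|.

Section Axis.
Variables (w : R) (s : seq (R * R)).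
Hypotheses (w_ge0 : 0 <= w) (axs : strip_axis w s).

Lemma seglen_gt i : (i.+1 < size s)%N ->
  (corner s i)%:R * (w / 2) + (corner s i.+1)%:R * (w / 2) < seglen s i.
Proof. by case: axs => _ _ h _ _; exact: h. Qed.

Lemma seglen_gt0 i : (i.+1 < size s)%N -> 0 < seglen s i.
Proof.
move=> hi; apply: le_lt_trans (seglen_gt hi).
by apply: addr_ge0; apply: mulr_ge0; rewrite ?ler0n ?divr_ge0.
Qed.

Lemma axis_dir i : (i.+1 < size s)%N -> unitv (udir s i) /\
  s`_i.+1 = pt s`_i (udir s i) (seglen s i) 0.
Proof.
move=> hi; apply: direction_unitv (seglen_gt0 hi).
by case: axs => _ h _ _ _; exact: h.
Qed.

Lemma udir_unitv i : (i.+1 < size s)%N -> unitv (udir s i).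
Proof. by move=> /axis_dir[]. Qed.

Lemma nth_next i : (i.+1 < size s)%N ->
  s`_i.+1 = pt s`_i (udir s i) (seglen s i) 0.
Proof. by move=> /axis_dir[]. Qed.

(** Consecutive segments are perpendicular, so the next frame is a translated and rotated copy; [sg]
    is 1 for a left turn and -1 for a right turn. All comparisons of adjacent cells rest on these
    two formulas. *)
Lemma turn i : (i.+2 < size s)%N -> exists2 sg : R, sg = 1 \/ sg = -1 &
  forall z, along s`_i.+1 (udir s i.+1) z = sg * across s`_i (udir s i) z /\
    across s`_i.+1 (udir s i.+1) z = - sg * (along s`_i (udir s i) z - seglen s i).
Proof.
move=> hi; have hi' := ltnW hi.
have := nth_next hi; have := udir_unitv hi; have := seglen_gt0 hi.
have := nth_next hi'; have := udir_unitv hi'; have := seglen_gt0 hi'.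
have : (horizontal s`_i s`_i.+1) = (vertical s`_i.+1 s`_i.+2).
  by case: axs => _ _ _ h _; exact: h.
move: (udir s i) (udir s i.+1) (seglen s i) (seglen s i.+1) => u u' l l'.
move: s`_i s`_i.+1 s`_i.+2 => a b c hv l0 hu eb l0' hu' e; subst b c; move: hv.
rewrite /horizontal /vertical /pt /along /across => hv.
have hh : u.2 = 0 <-> u'.1 = 0.
  split=> h.
    have : a.2 == a.2 + l * u.2 + 0 * u.1 by rewrite h; apply/eqP; lra.
    rewrite hv /= => /eqP k.
    have /eqP : l' * u'.1 = 0 by lra.
    by rewrite mulf_eq0 gt_eqF //= => /eqP.
  have : a.1 + l * u.1 - 0 * u.2 == a.1 + l * u.1 - 0 * u.2 + l' * u'.1 - 0 * u'.2.
    by rewrite h; apply/eqP; lra.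
  rewrite -hv /= => /eqP k.
  have /eqP : l * u.2 = 0 by lra.
  by rewrite mulf_eq0 gt_eqF //= => /eqP.
move: hu hu' hh => [->|[->|[->|->]]] [->|[->|[->|->]]] /= hh; try (exfalso; lra).
all: try by exists 1; [left|move=> z; split; lra].
all: try by exists (-1); [right|move=> z; split; lra].
all: exfalso; case: hh => h1 h2; first [have := h1 erefl; lra | have := h2 erefl; lra].
Qed.

Lemma axis_piece t i : 0 <= t <= w -> (i.+1 < size s)%N ->
  piece t s i = frect s`_i (udir s i) (- ((corner s i)%:R * (t / 2)))
    (seglen s i + (corner s i.+1)%:R * (t / 2)) (- (t / 2)) (t / 2).
Proof.
move=> /andP[t0 tw] hi; apply: pieceE => //; [exact: udir_unitv|exact: seglen_gt0| |exact: nth_next].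
apply: le_trans (ltW (seglen_gt hi)).
by apply: lerD; apply: ler_wpM2l; rewrite ?ler0n // ler_pM2r.
Qed.

Lemma axis_pieceS t i : 0 <= t <= w -> (i.+1 < size s)%N -> piece t s i `<=` piece w s i.
Proof.
move=> tw hi; rewrite axis_piece // axis_piece ?w_ge0 ?lexx // => z [h1 h2].
by move: h1; rewrite /frect /=; do 2![case: (corner _ _)] => /= h1; split; lra.
Qed.

Lemma strip_axisS t : 0 <= t <= w -> strip_axis t s.
Proof.
move=> tw; case: (axs) => h1 h2 h3 h4 h5; split => // [i hi|i j ij js].
  apply: le_lt_trans (h3 i hi).
  by apply: lerD; apply: ler_wpM2l; rewrite ?ler0n //; lra.
apply/seteqP; split => // z [zi zj].
have hi : (i.+1 < size s)%N by exact: ltn_trans ij (ltnW js).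
have : (piece w s i `&` piece w s j) z.
  by split; [exact: axis_pieceS zi|exact: axis_pieceS zj].
by rewrite h5.
Qed.

End Axis.

End Segments.

(** * Canals in the frames of the island axis, and reversal of an axis *)

Section Tubes.
Context {R : realType}.
Implicit Types (a b u z y : R * R) (s : seq (R * R)) (w t d : R).

Definition cell t s d0 d1 i : set (R * R) :=
  frect s`_i (udir s i) (if i == 0%N then d0 else - (t / 2))
    (seglen s i + (if i.+2 == size s then - d1 else t / 2)) (- (t / 2)) (t / 2).

(* The strip of width [t] around the axis [s] shortened by [d0] and [d1] at its
   two ends, in the coordinates of the segments of [s] itself. *)
Definition tube t s d0 d1 : set (R * R) :=
  [set z | exists2 i, (i.+1 < size s)%N & cell t s d0 d1 i z].

Lemma corner_ends s i : (i.+1 < size s)%N ->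
  corner s i = (i != 0%N) /\ corner s i.+1 = (i.+2 != size s).
Proof. by rewrite /corner => hi; split; lia. Qed.

Lemma two_ends s i : (2 < size s)%N -> (i != 0%N) || (i.+2 != size s).
Proof. lia. Qed.

Lemma piece_cell w s t i : 0 <= w -> strip_axis w s -> 0 <= t <= w ->
  (i.+1 < size s)%N -> piece t s i = cell t s 0 0 i.
Proof.
move=> w0 axs tw hi; rewrite (axis_piece w0 axs) // /cell.
have [-> ->] := corner_ends hi.
by case: (i == 0)%N; case: (i.+2 == size s)%N => /=; congr frect; lra.
Qed.

Lemma strip_tube w s t : 0 <= w -> strip_axis w s -> 0 <= t <= w ->
  strip t s = tube t s 0 0.
Proof.
move=> w0 axs tw; apply/seteqP; split => z [i hi] h; exists i => //.
  by rewrite -(piece_cell w0 axs).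
by rewrite (piece_cell w0 axs).
Qed.

Lemma rev_nth s i : (i < size s)%N -> (rev s)`_i = s`_(size s - i.+1).
Proof. exact: nth_rev. Qed.

Lemma bandC w a b : band w a b = band w b a.
Proof.
by apply/seteqP; split => z /= [[h [h1 h2]]|[h [h1 h2]]]; [left|right|left|right];
  split => //; rewrite minC maxC; split => //; rewrite -h // h.
Qed.

Lemma corner_rev s i : (i < size s)%N -> corner (rev s) i = corner s (size s - i.+1).
Proof. by rewrite /corner size_rev => h; lia. Qed.

Lemma rev_idx s i : (i.+1 < size s)%N -> exists2 j, (j.+1 < size s)%N &
  [/\ (rev s)`_i = s`_j.+1, (rev s)`_i.+1 = s`_j, (i + j).+2 = size s,
      corner (rev s) i = corner s j.+1 & corner (rev s) i.+1 = corner s j].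
Proof.
move=> hi; exists (size s - i.+2)%N; first lia.
have e : (size s - i.+2).+1 = (size s - i.+1)%N by lia.
by split; rewrite ?rev_nth ?corner_rev ?e //; lia.
Qed.

Lemma piece_rev w s i j : (i + j).+2 = size s -> piece w (rev s) i = piece w s j.
Proof.
move=> ij; have [|k hk [h1 h2 h3 h4 h5]] := @rev_idx s i; first lia.
have -> : j = k by lia.
by rewrite /piece h1 h2 h4 h5 bandC setUAC.
Qed.

Lemma strip_axis_rev w s : 0 <= w -> strip_axis w s -> strip_axis w (rev s).
Proof.
move=> w0 axs; case: (axs) => h1 h2 h3 h4 h5.
have C1 a b : horizontal a b = horizontal b a by rewrite /horizontal eq_sym.
have C2 a b : vertical a b = vertical b a by rewrite /vertical eq_sym.
(* Alternation equates [horizontal] of a segment with [vertical] of the next one. It can be read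
   backwards because the two are complementary on segments of positive length. *)
have hv i : (i.+1 < size s)%N -> vertical s`_i s`_i.+1 = ~~ horizontal s`_i s`_i.+1.
  move=> hi; have := h2 i hi; have := seglen_gt0 w0 axs hi; rewrite /seglen.
  case E : (horizontal _ _) => //=; case F : (vertical _ _) => //.
  move: E F; rewrite /horizontal /vertical => /eqP e /eqP f.
  by rewrite prod_normE /= e f !subrr normr0 max_l // ltxx.
split; rewrite size_rev //.
- move=> i hi; have [j hj [-> -> _ _ _]] := rev_idx hi.
  by rewrite C1 C2; exact: h2.
- move=> i hi; have [j hj [-> -> _ -> ->]] := rev_idx hi.
  by rewrite distrC addrC; exact: h3.
- move=> i hi; rewrite !rev_nth; try lia.
  have e1 : (size s - i.+1 = (size s - i.+3).+2)%N by lia.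
  have e2 : (size s - i.+2 = (size s - i.+3).+1)%N by lia.
  rewrite e1 e2 C1 C2 hv; last lia.
  rewrite (h4 (size s - i.+3)%N); last lia.
  by rewrite hv ?negbK //; lia.
- move=> i j ij js.
  rewrite (@piece_rev w s i (size s - i.+2)); last lia.
  rewrite (@piece_rev w s j (size s - j.+2)); last lia.
  by rewrite setIC; apply: h5; lia.
Qed.

Section Axis.
Variables (w : R) (s : seq (R * R)).
Hypotheses (w_ge0 : 0 <= w) (axs : strip_axis w s).

(** Reversal turns the frame of a segment by a half turn and moves its origin to the other end. *)
Lemma frame_rev i j : (i + j).+2 = size s ->
  [/\ udir (rev s) i = (- (udir s j).1, - (udir s j).2), seglen (rev s) i = seglen s j &
   forall z, along (rev s)`_i (udir (rev s) i) z = seglen s j - along s`_j (udir s j) z /\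
     across (rev s)`_i (udir (rev s) i) z = - across s`_j (udir s j) z].
Proof.
move=> ij; have [|k hk [h1 h2 h3 h4 h5]] := @rev_idx s i; first lia.
have -> : j = k by lia.
have e : udir (rev s) i = (- (udir s k).1, - (udir s k).2).
  by rewrite /udir h1 h2 directionC.
split => // [|z]; first by rewrite /seglen h1 h2 distrC.
rewrite e h1 (nth_next w_ge0 axs hk).
have := udir_unitv w_ge0 axs hk.
by rewrite /along /across /pt => -[->|[->|[->|->]]] /=; split; lra.
Qed.

Lemma cell_rev t d0 d1 i j : (i + j).+2 = size s ->
  cell t (rev s) d0 d1 i = cell t s d1 d0 j.
Proof.
move=> ij; have [h1 h2 h3] := frame_rev ij.
rewrite /cell size_rev.
have -> : (i.+2 == size s) = (j == 0)%N by lia.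
have -> : (j.+2 == size s) = (i == 0)%N by lia.
apply/seteqP; split => z; rewrite /frect /= ?(h3 z).1 ?(h3 z).2 h2;
  case: (i == 0)%N; case: (j == 0)%N => -[k1 k2]; split; lra.
Qed.

Lemma tube_rev t d0 d1 : tube t (rev s) d0 d1 = tube t s d1 d0.
Proof.
apply/seteqP; split => z [i]; rewrite ?size_rev => hi h; exists (size s - i.+2)%N;
  rewrite ?size_rev; try lia.
  by rewrite -(@cell_rev t d0 d1 i) //; lia.
by rewrite (@cell_rev t d0 d1 _ i) //; lia.
Qed.

(** A segment is longer than [3 / 2 * t] for each adjacent corner and loses at most [t], at one end
    only; the half corner squares of width [t] therefore still fit. *)
Lemma tube_shorten t s' d0 d1 : 0 < t -> 3 * t <= w -> 0 <= d0 <= t -> 0 <= d1 <= t ->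
  (2 < size s)%N -> size s' = size s ->
  (forall i, (i < size s)%N -> s'`_i =
     if i == 0%N then pt s`_0 (udir s 0) d0 0
     else if i.+1 == size s then pt s`_i (udir s i.-1) (- d1) 0 else s`_i) ->
  strip t s' = tube t s d0 d1.
Proof.
move=> t0 tw hd0 hd1 s2 ss' ns'.
suff h i : (i.+1 < size s)%N -> piece t s' i = cell t s d0 d1 i.
  apply/seteqP; split => z [i /= hi] hz; exists i => //=.
  - by rewrite -ss'.
  - by rewrite -h // -ss'.
  - by rewrite ss'.
  - by rewrite h.
move=> hi; have hu := udir_unitv w_ge0 axs hi.
pose e0 := if i == 0%N then d0 else 0; pose e1 := if i.+2 == size s then d1 else 0.
have E0 : s'`_i = pt s`_i (udir s i) e0 0.
  rewrite ns' ?(ltnW hi) // /e0; case: (eqVneq i 0%N) => [-> //|i0].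
  have -> : (i.+1 == size s) = false by lia.
  by case: (s`_i) => x y; rewrite /pt /=; congr (_, _); lra.
have E1 : s'`_i.+1 = pt s`_i (udir s i) (seglen s i - e1) 0.
  rewrite ns' // /e1 /=; case: eqP => h; rewrite (nth_next w_ge0 axs hi) /pt /=;
   by congr (_, _); lra.
have gt := seglen_gt axs hi.
have [cs0 cs1] := corner_ends hi; have iN := two_ends i s2.
have [c0 c1] : corner s' i = (i != 0%N) /\ corner s' i.+1 = (i.+2 != size s).
  by have := @corner_ends s' i; rewrite ss'; apply.
have big : (corner s' i)%:R * (t / 2) + (corner s' i.+1)%:R * (t / 2) <
    seglen s i - e1 - e0.
  move: gt; rewrite c0 c1 cs0 cs1 /e0 /e1.
  by move: iN; case: (i == 0)%N; case: (i.+2 == size s)%N => //= _; lra.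
have l0 : 0 < seglen s i - e1 - e0.
  apply: le_lt_trans big; apply: addr_ge0; apply: mulr_ge0; rewrite ?ler0n //; lra.
rewrite (@pieceE _ _ _ _ (udir s i) (seglen s i - e1 - e0)) ?(ltW t0) ?(ltW big) //; last first.
  by rewrite E0 E1 pt_pt; congr pt; lra.
rewrite E0 c0 c1 /cell /frect; apply/seteqP; split => z /=;
 rewrite /e0 /e1 along_shift // across_shift // subr0;
 case: (i == 0)%N; case: (i.+2 == size s)%N => /= -[h1 h2];
 clear -h1 h2; split; lra.
Qed.

End Axis.

Lemma size_trim_head d s : size (trim_head d s) = size s.
Proof. by case: s => [|a [|b s]]. Qed.

Lemma size_trim_last d s : size (trim_last d s) = size s.
Proof. by rewrite size_rev size_trim_head size_rev. Qed.

Lemma nth_trim_head d s i : (1 < size s)%N -> (trim_head d s)`_i =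
  if i == 0%N then pt s`_0 (udir s 0) d 0 else s`_i.
Proof.
case: s => [|a [|b s]] //= _; case: i => [|i] //=.
by rewrite /pt /udir /direction /=; congr (_, _); lra.
Qed.

Lemma nth_trim_last d s i : (1 < size s)%N -> (i < size s)%N -> (trim_last d s)`_i =
  if i.+1 == size s then pt s`_i (udir s i.-1) (- d) 0 else s`_i.
Proof.
move=> s1 si; rewrite /trim_last rev_nth ?size_trim_head ?size_rev //.
rewrite nth_trim_head ?size_rev //.
have -> : (size s - i.+1 == 0)%N = (i.+1 == size s) by lia.
case: eqP => [e|_]; last by rewrite rev_nth; [congr nth; lia|lia].
rewrite /udir !rev_nth //; try lia.
have -> : (size s - 1 = i)%N by lia.
have -> : (size s - 2 = i.-1)%N by lia.
have <- : i = i.-1.+1 by lia.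
by rewrite directionC /pt /=; congr (_, _); lra.
Qed.

End Tubes.

(** * A canal of width [t] inside an island of width [3 * t] *)

Section Strip.
Context {R : realType}.
Implicit Types (a b u z y p q nu : R * R) (d x h : R) (i j : nat).

Variables (t : R) (s : seq (R * R)).
Hypotheses (t_gt0 : 0 < t) (axs : strip_axis (3 * t) s) (s_gt2 : (2 < size s)%N).

Local Notation w := (3 * t).
Local Notation al i := (along s`_i (udir s i)).
Local Notation ac i := (across s`_i (udir s i)).
Local Notation S := (strip w s).

Let w_ge0 : 0 <= w. Proof. by rewrite mulr_ge0 // ltW. Qed.
Let hu i : (i.+1 < size s)%N -> unitv (udir s i). Proof. exact: (udir_unitv w_ge0 axs). Qed.

Lemma strip_cells : S = tube w s 0 0.
Proof. by apply: (strip_tube w_ge0 axs); rewrite w_ge0 lexx. Qed.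

Lemma seglen_lb i : (i.+1 < size s)%N -> 3 / 2 * t < seglen s i /\
  ((0 < i)%N -> (i.+2 < size s)%N -> 3 * t < seglen s i).
Proof.
move=> hi; have t0 := t_gt0; have := seglen_gt axs hi.
have [-> ->] := corner_ends hi; have := two_ends i s_gt2.
rewrite lt0n (ltn_neqAle i.+2) hi andbT.
by case: (i == 0)%N; case: (_ == size s) => //= _ h; split => //; lra.
Qed.

Lemma cellS d0 d1 i : 0 <= d0 -> 0 <= d1 -> cell t s d0 d1 i `<=` cell w s 0 0 i.
Proof.
have t0 := t_gt0.
move=> h0 h1 z; rewrite /cell /frect /=; case: (i == 0)%N; case: (_ == size s) => -[k1 k2];
  split; lra.
Qed.

Lemma cell_strip i z : (i.+1 < size s)%N -> cell w s 0 0 i z -> S z.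
Proof. by move=> hi hz; rewrite strip_cells; exists i. Qed.

Lemma tubeS d0 d1 : 0 <= d0 -> 0 <= d1 -> tube t s d0 d1 `<=` S.
Proof. by move=> h0 h1 z [i hi /(cellS h0 h1)]; exact: cell_strip. Qed.

Lemma cell_disjoint i j z : (i.+1 < j)%N -> (j.+1 < size s)%N ->
  cell w s 0 0 i z -> cell w s 0 0 j z -> False.
Proof.
have t0 := t_gt0.
move=> ij js; have js' : (i.+1 < size s)%N by lia.
have ww : 0 <= w <= w by rewrite w_ge0 lexx.
rewrite -!(piece_cell w_ge0 axs ww) //.
move=> hi hj; have [_ _ _ _ h] := axs.
by have : (piece w s i `&` piece w s j) z by []; rewrite h.
Qed.

Lemma strip_int i z : (i.+1 < size s)%N ->
  (if i == 0%N then 0 else - (w / 2)) < al i z < seglen s i + (if i.+2 == size s then 0 else w / 2) ->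
  - (w / 2) < ac i z < w / 2 -> mint S z.
Proof.
move=> hi h1 h2.
have /mintS : cell w s 0 0 i `<=` S by move=> y; exact: cell_strip.
apply; apply: mintS (@ofrect_sub _ _ _ _ _ _ _) _ _.
by apply: ofrect_int; [exact: hu|split => //; move: h1; rewrite oppr0].
Qed.

(** The canal keeps the distance [t] from the long sides, so it can touch the boundary of the strip
    only in an end edge. *)
Lemma tube_int d0 d1 i z : (i.+1 < size s)%N -> 0 <= d0 -> 0 <= d1 ->
  cell t s d0 d1 i z -> (i = 0%N -> 0 < al i z) -> (i.+2 = size s -> al i z < seglen s i) ->
  mint S z.
Proof.
have t0 := t_gt0.
move=> hi h0 h1 hz k0 k1; apply: (strip_int hi); move: hz; rewrite /cell /frect /=.
  by case: eqP k0 => e0 k0; case: eqP k1 => e1 k1 [h h'];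
    [have := k0 e0; have := k1 e1|have := k0 e0|have := k1 e1|]; lra.
by case: (i == 0)%N; case: (_ == size s); lra.
Qed.

Lemma tube_co_open d0 d1 : co_open (tube t s d0 d1).
Proof.
apply: (@co_open_bigcup _ _ _ (size s)) => i /= hi; first lia.
by apply: frect_co_open; exact: hu.
Qed.

Lemma cell_size d0 d1 i : (i.+1 < size s)%N -> d0 <= t -> d1 <= t ->
  (if i == 0%N then d0 else - (t / 2)) <
    seglen s i + (if i.+2 == size s then - d1 else t / 2).
Proof.
have t0 := t_gt0.
move=> hi h0 h1; have [l1 _] := seglen_lb hi.
have := two_ends i s_gt2.
by case: (i == 0)%N; case: (_ == size s) => //= _; lra.
Qed.

Lemma tube_mint_dense d0 d1 : d0 <= t -> d1 <= t -> mint_dense (tube t s d0 d1).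
Proof.
have t0 := t_gt0.
move=> h0 h1; apply: mint_dense_bigcup => i /= hi.
by apply: frect_mint_dense; [exact: hu|exact: cell_size|lra].
Qed.

(** Across a segment the axis is at most [3 / 2 * t] away, and along it the canal cell is shorter
    than the island cell by [t] at each end. *)
Lemma tube_near z : S z -> exists2 y, nbd z (2 * t) y & tube t s t t y.
Proof.
have t0 := t_gt0.
rewrite strip_cells => -[i hi hz].
have lh := @cell_size t t i hi (lexx t) (lexx t).
have [x [x1 x2] xz] : exists2 x, ((if i == 0%N then t else - (t / 2)) <= x /\
    x <= seglen s i + (if i.+2 == size s then - t else t / 2)) & - (2 * t) < x - al i z < 2 * t.
  move: hz lh; rewrite /cell /frect /=.
  set lo := (if _ then t else _); set up := _ + (if _ then _ else t / 2) => hz lh.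
  have hz' : lo - 3 / 2 * t <= al i z <= up + 3 / 2 * t.
    by move: hz; rewrite /lo /up; case: (i == 0)%N; case: (_ == size s); lra.
  have [k|k] := leP (al i z) lo; first by exists lo; lra.
  have [k'|k'] := leP up (al i z); first by exists up; lra.
  by exists (al i z); lra.
exists (pt s`_i (udir s i) x 0).
  apply/(nbdE s`_i (hu hi)); rewrite along_pt ?across_pt; try exact: hu.
  by split => //; move: hz => [_ /=]; lra.
exists i => //; split; rewrite ?along_pt ?across_pt; try exact: hu; last by lra.
by rewrite x1 x2.
Qed.

(* [y1] and [y2] face each other across the canal, in the two walls that it leaves;
   the band joining a canal to a lake is too exists_lt3 to contain both. *)
Lemma strip_walls z : S z -> exists y1 y2 a u, [/\ unitv u, mint S y1, mint S y2,
    ~ tube t s 0 0 y1 & ~ tube t s 0 0 y2] /\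
  [/\ nbd z (6 * t) y1, nbd z (6 * t) y2 &
    (along a u y1 = along a u y2 /\ across a u y1 - across a u y2 = 8 / 3 * t)].
Proof.
have t0 := t_gt0.
rewrite {1}strip_cells => -[i hi hz].
have [l1 l2] := seglen_lb hi.
(* [lo] and [hi'] cut off the corner squares: over the straight part that remains, no canal cell of
   an adjacent segment crosses the walls. *)
pose lo := if i == 0%N then 0 else w / 2.
pose hi' := seglen s i - (if i.+2 == size s then 0 else w / 2).
have lh : lo < hi'.
  have iN := two_ends i s_gt2.
  move: l2 iN; rewrite /lo /hi' lt0n (ltn_neqAle i.+2) hi andbT.
  case: (i == 0)%N; case: (_ == size s) => //= {}l2 _; [lra|lra|].
  by have := l2 isT isT; lra.
have [x xlo xz] : exists2 x : R, lo < x < hi' & - (4 * t) < x - al i z < 4 * t.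
  have z1 : lo - 3 * t <= al i z <= hi' + 3 * t.
    by move: hz; rewrite /lo /hi' /cell /frect /=; case: (i == 0)%N; case: (_ == size s); lra.
  have [h|h] := leP (al i z) lo.
    by have [x' ? ?] := @approx_inside _ lo hi' lo t lh ltac:(lra) t_gt0; exists x'; lra.
  have [h'|h'] := leP hi' (al i z).
    by have [x' ? ?] := @approx_inside _ lo hi' hi' t lh ltac:(lra) t_gt0; exists x'; lra.
  by exists (al i z); lra.
(* The walls occupy the ordinates between [t / 2] and [3 / 2 * t] on both sides. The difference
   [8 / 3 * t] of the chosen ordinates exceeds both sides of the connecting band, [t] and
   [3 / 2 * t]. *)
have inS (y : R) : y = 4 / 3 * t \/ y = - (4 / 3 * t) -> mint S (pt s`_i (udir s i) x y).
  move=> hy; apply: (strip_int hi); rewrite ?along_pt ?across_pt; try exact: hu.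
    by move: xlo; rewrite /lo /hi'; case: (i == 0)%N; case: (_ == size s); lra.
  by case: hy => ->; lra.
have notT (y : R) : y = 4 / 3 * t \/ y = - (4 / 3 * t) -> ~ tube t s 0 0 (pt s`_i (udir s i) x y).
  move=> hy [j hj]; move: (hy) => /inS/mint_sub.
  set Y := pt _ _ _ _ => _ hY.
  have alY : al i Y = x by rewrite /Y along_pt //; exact: hu.
  have acY : ac i Y = y by rewrite /Y across_pt //; exact: hu.
  have Yi : cell w s 0 0 i Y.
    rewrite /cell /frect /= alY acY; move: xlo hy; rewrite /lo /hi'; clear -t0.
    by case: (i == 0)%N; case: (_ == size s) => ? [->|->]; split; lra.
  have Yj := @cellS 0 0 j (lexx 0) (lexx 0) _ hY.
  have [ij|ji|ij] := ltngtP i j; last first.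
  - move: hY; rewrite -ij => -[_]; rewrite acY; case: hy => ->; lra.
  - have [ji1|ji1] := eqVneq j.+1 i; last first.
      by apply: (@cell_disjoint j i Y) => //; rewrite ltn_neqAle ji1 ji.
    subst i; have [sg hsg /(_ Y) [e1 e2]] := turn w_ge0 axs hi.
    case: hY => _; rewrite alY in e1; move: xlo e1; rewrite /lo /=.
    by case: hsg => ->; lra.
  - have [ji1|ji1] := eqVneq j i.+1; last first.
      by apply: (@cell_disjoint i j Y) => //; rewrite ltn_neqAle eq_sym ji1 ij.
    subst j; have [sg hsg /(_ Y) [e1 e2]] := turn w_ge0 axs hj.
    case: hY => _; rewrite alY in e2; move: xlo e2; rewrite /hi'.
    have -> : (i.+2 == size s) = false by lia.
    by case: hsg => ->; lra.
have near (y : R) : y = 4 / 3 * t \/ y = - (4 / 3 * t) -> nbd z (6 * t) (pt s`_i (udir s i) x y).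
  move=> hy; apply/(nbdE s`_i (hu hi)); rewrite along_pt ?across_pt; try exact: hu.
  by move: hz => [_ /= ?]; split; first lra; case: hy => ->; lra.
exists (pt s`_i (udir s i) x (4 / 3 * t)), (pt s`_i (udir s i) x (- (4 / 3 * t))).
have ui := hu hi.
exists s`_i, (udir s i); split; split.
- exact: ui.
- by apply: inS; left.
- by apply: inS; right.
- by apply: notT; left.
- by apply: notT; right.
- by apply: near; left.
- by apply: near; right.
- by rewrite !along_pt // !across_pt //; split => //; lra.
Qed.

(* Near a corner of an end edge the strip is only a quarter of a neighbourhood. *)
Lemma end_corner (eta : R) : eta = 1 \/ eta = -1 ->
  exists2 rho, 0 < rho & forall z, nbd (pt s`_0 (udir s 0) 0 (eta * (w / 2))) rho z ->
    S z -> 0 <= al 0 z /\ - (w / 2) <= ac 0 z <= w / 2.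
Proof.
have t0 := t_gt0.
move=> heta; set e := pt _ _ _ _.
have h0 : (1 < size s)%N := ltnW s_gt2.
have [l1 _] := seglen_lb h0.
have ale : al 0 e = 0 by rewrite /e along_pt //; exact: hu.
have ace : ac 0 e = eta * (w / 2) by rewrite /e across_pt //; exact: hu.
have e0 : cell w s 0 0 0 e.
  rewrite /cell /frect /= ale ace; rewrite (ltn_eqF s_gt2).
  by case: heta => ->; split; lra.
(* The corner [e] is in no other cell, and the other cells form a closed set; so near [e] the strip
   is just its first cell. *)
have [|||rho rho0 hrho] := @co_open_bigcup _ [set j | (0 < j)%N /\ (j.+1 < size s)%N]
    (cell w s 0 0) (size s) _ _ e.
- by move=> j [_ hj]; lia.
- by move=> j [_ hj]; apply: frect_co_open; exact: hu.
- move=> [j [j0 hj] ej].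
  have [ji1|ji1] := eqVneq j 1%N; last first.
    by apply: (@cell_disjoint 0 j e) => //; rewrite ltn_neqAle eq_sym ji1.
  subst j; have [sg hsg /(_ e) [e1 e2]] := turn w_ge0 axs hj.
  by case: ej => _; rewrite ale in e2; move: e2; case: hsg => ->; lra.
exists rho => // z ze; rewrite strip_cells => -[j hj hz].
have [j0|j0] := eqVneq j 0%N; first by subst j; case: hz => /= h k; split; lra.
by exfalso; apply: (hrho z ze); exists j => //; split => //; lia.
Qed.

(** This is land left between the end edge and the tip of the canal. The second canal cell does not
    reach it because the first segment is longer than [3 / 2 * t]. *)
Lemma head_gap d1 z : 0 <= d1 -> 0 < al 0 z < t -> - (t / 2) < ac 0 z < t / 2 ->
  mint S z /\ ~ tube t s t d1 z.
Proof.
have t0 := t_gt0.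
move=> hd1 h1 h2; have h0 : (1 < size s)%N := ltnW s_gt2.
have [l1 _] := seglen_lb h0.
split.
  by apply: (strip_int h0); rewrite /= ?(ltn_eqF s_gt2); lra.
move=> [j hj hz].
have [j0|j0] := eqVneq j 0%N; first by subst j; case: hz => /= h k; lra.
have z0 : cell w s 0 0 0 z.
  rewrite /cell /frect /=; rewrite (ltn_eqF s_gt2).
  by split; lra.
have [j1|j1] := eqVneq j 1%N; last first.
  apply: (@cell_disjoint 0 j z) => //; first by rewrite ltn_neqAle eq_sym j1 lt0n.
  by apply: cellS hz => //; lra.
subst j; have [sg hsg /(_ z) [e1 e2]] := turn w_ge0 axs hj.
by case: hz => _; move: e2; case: hsg => ->; lra.
Qed.

End Strip.
(** * The connecting bands *)

Section Foot.
Context {R : realType}.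
Implicit Types (a b u z y p q nu : R * R) (d x h : R) (i j : nat) (s : seq (R * R)).

(** For a point on the side [eta] of a segment of direction [u]: forward, backward, outward and
    inward. *)
Lemma unit_cases u nu (eta : R) : unitv u -> unitv nu -> eta = 1 \/ eta = -1 ->
  [\/ nu = u, nu = (- u.1, - u.2), nu = (- (eta * u.2), eta * u.1)
    | nu = (eta * u.2, - (eta * u.1))].
Proof.
move=> [->|[->|[->|->]]] [->|[->|[->|->]]] [->|->] /=;
  rewrite ?mul1r ?mulN1r ?mulrN1 ?oppr0 ?opprK ?mulr0 ?oppr0;
  solve [by constructor 1|by constructor 2|by constructor 3|by constructor 4].
Qed.

Lemma along_inward a u (eta : R) z :
  along a (eta * u.2, - (eta * u.1)) z = - (eta * across a u z).
Proof. by rewrite /along /across /=; ring. Qed.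

Lemma across_inward a u (eta : R) z :
  across a (eta * u.2, - (eta * u.1)) z = eta * along a u z.
Proof. by rewrite /along /across /=; ring. Qed.

Lemma along_outward a u (eta : R) z :
  along a (- (eta * u.2), eta * u.1) z = eta * across a u z.
Proof. by rewrite /along /across /=; ring. Qed.

Lemma across_outward a u (eta : R) z :
  across a (- (eta * u.2), eta * u.1) z = - (eta * along a u z).
Proof. by rewrite /along /across /=; ring. Qed.

(* [p] is at abscissa [x] on the side [eta] of the [i]-th segment. *)
Definition foot_at (t : R) s i x (eta : R) p q : Prop :=
  [/\ (i.+1 < size s)%N, 0 <= x <= seglen s i, eta = 1 \/ eta = -1,
    p = pt s`_i (udir s i) x (eta * (3 * t / 2)) & q = pt s`_i (udir s i) x 0].

Section Strip.
Variables (t : R) (s : seq (R * R)).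
Hypotheses (t_gt0 : 0 < t) (axs : strip_axis (3 * t) s) (s_gt2 : (2 < size s)%N).

Local Notation w := (3 * t).
Local Notation al i := (along s`_i (udir s i)).
Local Notation ac i := (across s`_i (udir s i)).
Local Notation S := (strip w s).

Let w_ge0 : 0 <= w. Proof. by rewrite mulr_ge0 // ltW. Qed.
Let hu i : (i.+1 < size s)%N -> unitv (udir s i). Proof. exact: (udir_unitv w_ge0 axs). Qed.

Lemma footP p q : foot w s p q -> exists i x eta, foot_at t s i x eta p q.
Proof.
have t0 := t_gt0.
move=> [i [hi hq hp]]; have l0 := seglen_gt0 w_ge0 axs hi; have u1 := hu hi.
move: hq hp; rewrite (nth_next w_ge0 axs hi) bandE // => -[hq1 hq2] hp.
exists i, (al i q).
have acq : ac i q = 0 by lra.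
have eq : q = pt s`_i (udir s i) (al i q) 0 by rewrite -acq pt_along.
have hv : (horizontal s`_i (pt s`_i (udir s i) (seglen s i) 0) -> (udir s i).2 = 0) /\
   (vertical s`_i (pt s`_i (udir s i) (seglen s i) 0) -> (udir s i).1 = 0).
  rewrite /horizontal /vertical /pt.
  by case: u1 => [->|[->|[->|->]]] /=; split => // /eqP h; exfalso; lra.
have hp' : al i p = al i q /\ (ac i p = 3 * t / 2 \/ ac i p = - (3 * t / 2)).
  have nrm (r c : R) : `|r| = c -> r = c \/ r = - c.
    case: (lerP 0 r) => h; first by rewrite ger0_norm //; left.
    by rewrite ltr0_norm // => <-; right; rewrite opprK.
  rewrite /along /across in acq *.
  case: hp => -[h [e1 /nrm e2]]; [have u2 := hv.1 h|have u2 := hv.2 h]; clear hv h eq hq1 hq2;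
    move: (udir s i) u1 u2 acq => u [->|[->|[->|->]]] /= u2 acq; try (by exfalso; lra);
    by case: e2 => e2; split; [lra|first [left; lra|right; lra]|lra|first [left; lra|right; lra]].
case: hp' => e1 [e2|e2]; [exists 1|exists (-1)]; split => //; try by [left|right];
  by rewrite ?mul1r ?mulN1r -e1 -e2 pt_along.
Qed.

Lemma foot_rev i j x eta p q : (i + j).+2 = size s ->
  foot_at t s i x eta p q -> foot_at t (rev s) j (seglen s i - x) (- eta) p q.
Proof.
move=> ij [hi hx heta -> ->].
have ji : (j + i).+2 = size s by lia.
have [e1 e2 e3] := frame_rev w_ge0 axs ji.
have hp (y : R) : pt s`_i (udir s i) x y = pt (rev s)`_j (udir (rev s) j) (seglen s i - x) (- y).
  have hr : unitv (udir (rev s) j) by rewrite e1; apply: unitvN; exact: hu.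
  rewrite -[LHS](@pt_along _ (rev s)`_j (udir (rev s) j)) // (e3 _).1 (e3 _).2.
  by rewrite along_pt ?across_pt //; exact: hu.
split; rewrite ?size_rev ?e2 ?hp ?oppr0 ?mulNr //; [lia|lra|].
by case: heta => ->; [right|left]; rewrite ?opprK.
Qed.

Lemma foot_bandE i x eta p q : foot_at t s i x eta p q ->
  band t p q = [set z | x - t / 2 <= al i z <= x + t / 2 /\ 0 <= eta * ac i z <= w / 2].
Proof.
have t0 := t_gt0.
move=> [hi hx heta -> ->].
pose v : R * R := (eta * (udir s i).2, - (eta * (udir s i).1)).
have hv : unitv v.
  rewrite /v; case: (hu hi) heta => [->|[->|[->|->]]] [->|->] /=;
  rewrite ?mulr0 ?mulr1 ?mulrN1 ?oppr0 ?opprK /unitv; tauto.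
have -> : pt s`_i (udir s i) x 0 =
   pt (pt s`_i (udir s i) x (eta * (w / 2))) v (w / 2) 0.
  rewrite /pt /v /fst /snd; case: heta => ->; congr (_, _); lra.
rewrite bandE //; last lra.
have ui := hu hi.
apply/seteqP; split => z; rewrite /frect /= along_inward across_inward along_shift //
  across_shift //; case: heta => -> -[h1 h2]; split; lra.
Qed.

Section Orientation.
Variables (p q nu : R * R) (h delta : R).
Hypotheses (h_gt : 3 * t < h) (delta_gt0 : 0 < delta).
Hypothesis ahead : forall y : R, - h < y < h -> exists2 rho : R, 0 < rho &
  forall z, nbd (pt p nu 0 y) rho z -> 0 < along p nu z -> S z.
Hypothesis behind : forall z, - delta < along p nu z < 0 -> - h < across p nu z < h -> ~ S z.

Lemma exists_lt3 (c1 c2 c3 : R) : 0 < c1 -> 0 < c2 -> 0 < c3 ->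
  exists e, [/\ 0 < e, e < c1, e < c2 & e < c3].
Proof.
move=> h1 h2 h3; exists (Num.min c1 (Num.min c2 c3) / 2).
have h0 : 0 < Num.min c1 (Num.min c2 c3) by rewrite !lt_min h1 h2 h3.
have k1 : Num.min c1 (Num.min c2 c3) <= c1 by rewrite ge_min lexx.
have k2 : Num.min c1 (Num.min c2 c3) <= c2 by rewrite !ge_min lexx orbT.
have k3 : Num.min c1 (Num.min c2 c3) <= c3 by rewrite !ge_min lexx !orbT.
by split; lra.
Qed.

(** In use, [p] is a peak of the canal dug three days before, [nu] its outward normal and [h] half
    the width of that canal. Were [nu] to point out of the strip, the land just inside the wall at
    [p] would lie behind the edge, against [behind]. *)
Lemma not_outward i x eta : foot_at t s i x eta p q ->
  nu <> (- (eta * (udir s i).2), eta * (udir s i).1).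
Proof.
have t0 := t_gt0; have d0 := delta_gt0; have hgt := h_gt.
move=> [hi hx heta ep eq] enu.
have [e [e0 e1 e2 _]] := exists_lt3 d0 t0 t0.
pose z := pt s`_i (udir s i) x (eta * (3 * t / 2 - e)).
apply: (@behind z); last first.
- apply: (cell_strip t_gt0 axs hi).
  rewrite /cell /frect /z /= along_pt ?across_pt; try exact: hu.
  by case: (i == 0)%N; case: (_ == size s); case: heta => ->; split; lra.
- rewrite enu across_outward /z ep along_shift ?along_pt; try exact: hu.
  by case: heta => ->; lra.
- rewrite enu along_outward /z ep across_shift ?across_pt; try exact: hu.
  by case: heta => ->; lra.
Qed.

(** If [nu] ran along the segment, the strip would continue behind [p], unless [p] is a corner of
    the first end edge. There the strip is a quarter of a neighbourhood, while [ahead] asks for a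
    half. *)
Lemma not_forward i x eta : foot_at t s i x eta p q -> nu <> udir s i.
Proof.
have t0 := t_gt0; have d0 := delta_gt0; have hgt := h_gt.
move=> [hi hx heta ep eq] enu; have u1 := hu hi.
have [[i0 x0]|ix] := pselect (i = 0%N /\ x = 0).
  subst i x; have [rho r0 hrho] := end_corner t_gt0 axs s_gt2 heta.
  have [|rho' r0' hrho'] := ahead (y := 0); first by lra.
  have [e [e0 e1 e2 _]] := exists_lt3 r0 r0' t0.
  pose z := pt s`_0 (udir s 0) e (eta * (3 * t / 2 + e)).
  have [] := hrho z.
  - by apply/(nbdE s`_0 u1); rewrite !along_pt ?across_pt //; case: heta => ->; split; lra.
  - apply: hrho'.
      rewrite ep enu; have -> : pt (pt s`_0 (udir s 0) 0 (eta * (3 * t / 2))) (udir s 0) 0 0 =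
         pt s`_0 (udir s 0) 0 (eta * (3 * t / 2)) by rewrite /pt /=; congr (_, _); lra.
      by apply/(nbdE s`_0 u1); rewrite !along_pt ?across_pt //; case: heta => ->; split; lra.
    by rewrite ep enu /z along_shift // along_pt //; lra.
  by rewrite across_pt //; case: heta => ->; lra.
have [e [e0 e1 e2 e3]] : exists e, [/\ 0 < e, e < delta, e < t & (i = 0%N -> e < x)].
  have [i0|i0] := pselect (i = 0%N); last by have [e [? ? ? ?]] := exists_lt3 d0 t0 t0; exists e.
  have x0 : 0 < x by rewrite lt_neqAle eq_sym; case/andP: hx => -> _; rewrite andbT;
    apply/eqP => x0; apply: ix.
  by have [e [? ? ? ?]] := exists_lt3 d0 t0 x0; exists e.
pose z := pt s`_i (udir s i) (x - e) (eta * (3 * t / 2 - e)).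
apply: (@behind z); last first.
- apply: (cell_strip t_gt0 axs hi).
  rewrite /cell /frect /z /= along_pt ?across_pt //.
  by case: eqP e3 => [i0 /(_ i0)|_ _]; case: (_ == size s); case: heta => ->; split; lra.
- by rewrite /z ep enu across_shift // across_pt //; case: heta => ->; lra.
- by rewrite /z ep enu along_shift // along_pt //; lra.
Qed.

(** Otherwise a corner of the end edge would lie on the edge of the earlier canal, less than
    [2 * t < h] away from [p], and [ahead] would again turn a quarter of a neighbourhood into a
    half. *)
Lemma far_from_head i x eta : foot_at t s i x eta p q ->
  nu = (eta * (udir s i).2, - (eta * (udir s i).1)) -> i = 0%N -> 2 * t <= x.
Proof.
have t0 := t_gt0; have d0 := delta_gt0; have hgt := h_gt.
move=> [hi hx heta ep eq] enu i0; subst i; have u1 := hu hi.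
rewrite leNgt; apply/negP => xt.
have [rho r0 hrho] := end_corner t_gt0 axs s_gt2 heta.
have [|rho' r0' hrho'] := ahead (y := - (eta * x)); first by case: heta => ->; lra.
have [e [e0 e1 e2 _]] := exists_lt3 r0 r0' t0.
pose z := pt s`_0 (udir s 0) (- e) (eta * (3 * t / 2 - e)).
have [] := hrho z.
- by apply/(nbdE s`_0 u1); rewrite !along_pt ?across_pt //; case: heta => ->; split; lra.
- apply: hrho'.
    have -> : pt p nu 0 (- (eta * x)) = pt s`_0 (udir s 0) 0 (eta * (3 * t / 2)).
      by rewrite ep enu /pt /fst /snd; case: heta => ->; congr (_, _); lra.
    by apply/(nbdE s`_0 u1); rewrite !along_pt ?across_pt //; case: heta => ->; split; lra.
  by rewrite enu along_inward /z ep across_shift // across_pt //; case: heta => ->; lra.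
by rewrite along_pt //; lra.
Qed.

End Orientation.

End Strip.


End Foot.

(** * Connecting bands that enter perpendicularly, far from the end edges *)

Section GoodFeet.
Context {R : realType}.
Implicit Types (a b u z y p q nu : R * R) (d x h : R) (i j : nat) (s : seq (R * R)).

(* The canal enters through a straight part of the wall, away from the ends. *)
Definition good_foot (t : R) s i x (eta : R) p q nu : Prop :=
  [/\ foot_at t s i x eta p q, nu = (eta * (udir s i).2, - (eta * (udir s i).1)),
     (i = 0%N -> 2 * t <= x) & (i.+2 = size s -> x <= seglen s i - 2 * t)].

(** The outward and forward directions are excluded on the axis itself; the backward direction and
    the vicinity of the last end are excluded on the reversed axis. *)
Lemma good_footP (t : R) s p q nu (h delta : R) :
  0 < t -> strip_axis (3 * t) s -> (2 < size s)%N ->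
  unitv nu -> 3 * t < h -> 0 < delta ->
  (forall y : R, - h < y < h -> exists2 rho : R, 0 < rho &
    forall z, nbd (pt p nu 0 y) rho z -> 0 < along p nu z -> strip (3 * t) s z) ->
  (forall z, - delta < along p nu z < 0 -> - h < across p nu z < h -> ~ strip (3 * t) s z) ->
  foot (3 * t) s p q -> exists i x eta, good_foot t s i x eta p q nu.
Proof.
move=> t0 axs s2 nu1 ht d0 ahead behind /(footP t0 axs)[i [x [eta hf]]].
have w0 : 0 <= 3 * t by lra.
have axr := strip_axis_rev w0 axs.
have sr : strip (3 * t) (rev s) = strip (3 * t) s.
  by rewrite (strip_cells t0 axs) (strip_cells t0 axr) (tube_rev w0 axs).
have s2r : (2 < size (rev s))%N by rewrite size_rev.
have [hi hx heta _ _] := hf.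
pose j := (size s - i.+2)%N.
have ij : (i + j).+2 = size s by rewrite /j; lia.
have ji : (j + i).+2 = size s by lia.
have hr := foot_rev t0 axs s2 ij hf.
have [er _ _] := frame_rev w0 axs ji.
rewrite -sr in ahead behind.
have n3 := not_forward t0 axr s2r ht d0 ahead behind hr.
have n4 := far_from_head t0 axr s2r ht d0 ahead hr.
rewrite sr in ahead behind.
have n1 := not_outward t0 axs ht d0 behind hf.
have n2 := not_forward t0 axs s2 ht d0 ahead behind hf.
have u1 := udir_unitv w0 axs hi.
exists i, x, eta.
have e : nu = (eta * (udir s i).2, - (eta * (udir s i).1)).
  by case: (unit_cases u1 nu1 heta) => e //; exfalso; apply: n3; rewrite er.
split => //.
  exact: (far_from_head t0 axs s2 ht d0 ahead hf e).
move=> il; have : 2 * t <= seglen s i - x; last by lra.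
apply: n4; last by lia.
by rewrite er e /=; congr (_, _); lra.
Qed.

Section GoodFoot.
Variables (t : R) (s : seq (R * R)).
Hypotheses (t_gt0 : 0 < t) (axs : strip_axis (3 * t) s) (s_gt2 : (2 < size s)%N).
Variables (i : nat) (x eta : R) (p q nu : R * R).
Hypothesis gf : good_foot t s i x eta p q nu.

Local Notation w := (3 * t).
Local Notation al i := (along s`_i (udir s i)).
Local Notation ac i := (across s`_i (udir s i)).
Local Notation S := (strip w s).

Let w_ge0 : 0 <= w. Proof. by rewrite mulr_ge0 // ltW. Qed.
Let hu j : (j.+1 < size s)%N -> unitv (udir s j). Proof. exact: (udir_unitv w_ge0 axs). Qed.

Lemma foot_band_cell : band t p q `<=` cell w s 0 0 i.
Proof.
have t0 := t_gt0.
case: gf => hf e h0 h1; rewrite (foot_bandE t0 axs hf) => z [k1 k2].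
have [hi hx heta _ _] := hf.
rewrite /cell /frect /=.
by case: eqP h0 => [e0 /(_ e0)|_ _]; case: eqP h1 => [e1 /(_ e1)|_ _];
  case: heta k2 => -> k2; split; lra.
Qed.

Lemma foot_band_strip : band t p q `<=` S.
Proof.
case: gf => -[hi _ _ _ _] _ _ _.
by move=> z /foot_band_cell; exact: cell_strip.
Qed.

(** The second case is the edge of the band through [p], the only part of the band that can lie on
    the boundary of the strip. *)
Lemma foot_band_int z : band t p q z ->
  mint S z \/ (along p nu z = 0 /\ - (t / 2) <= across p nu z <= t / 2).
Proof.
have t0 := t_gt0.
case: gf => hf e h0 h1; rewrite (foot_bandE t0 axs hf) => -[k1 k2].
have [hi hx heta ep _] := hf; have u1 := hu hi.
have [k3|k3] := eqVneq (eta * ac i z) (w / 2); [right|left].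
  rewrite e along_inward across_inward ep across_shift // along_shift //.
  by case: heta k3 => -> k3; split; lra.
have k4 : eta * ac i z < w / 2 by rewrite lt_neqAle k3; case/andP: k2.
apply: (strip_int t0 axs hi); last by case: heta k2 k4 => ->; lra.
by case: eqP h0 => [e0 /(_ e0)|_ _]; case: eqP h1 => [e1 /(_ e1)|_ _]; lra.
Qed.

(** A band on the first segment starts at abscissa [3 / 2 * t] or later. A band on the second
    segment that reached the gap would come from the side facing it, and [p] would then be interior
    to the first cell. Later cells are disjoint from the first. *)
Lemma foot_band_gap z : ~ mint S p -> 0 < al 0 z < t -> - (t / 2) < ac 0 z < t / 2 ->
  ~ band t p q z.
Proof.
have t0 := t_gt0.
move=> np h1 h2 /[dup] /foot_band_cell zi; have h0 : (1 < size s)%N := ltnW s_gt2.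
have [l1 _] := seglen_lb t0 axs s_gt2 h0.
case: (gf) => hf e k0 k1; rewrite (foot_bandE t0 axs hf) => -[b1 b2].
have [hi hx heta ep _] := hf.
have z0 : cell w s 0 0 0 z.
  rewrite /cell /frect /=; rewrite (ltn_eqF s_gt2).
  by split; lra.
have [i0|i0] := eqVneq i 0%N; first by subst i; have := k0 erefl; lra.
have [i1|i1] := eqVneq i 1%N; last first.
  by apply: (cell_disjoint t0 axs s_gt2 _ hi z0 zi); rewrite ltn_neqAle eq_sym i1 lt0n.
subst i; have [sg hsg ht] := turn w_ge0 axs hi.
have [/esym e1 e2] := ht z; have [/esym e3 e4] := ht p.
have acp : ac 1 p = eta * (w / 2) by rewrite ep across_pt //; exact: hu.
have alp : al 1 p = x by rewrite ep along_pt //; exact: hu.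
apply: np; apply: (strip_int t0 axs h0) => /=.
  rewrite (ltn_eqF s_gt2).
  by case: hsg heta e1 e2 e3 e4 acp alp b2 => -> [->|->]; lra.
by case: hsg heta e1 e2 e3 e4 acp alp b2 => -> [->|->]; lra.
Qed.

End GoodFoot.
End GoodFeet.
(** * Areas and lengths *)

Section Area.
Context {R : realType}.
Implicit Types (a b u z y : R * R) (S : set (R * R)).

Definition area S : \bar R := (@lebesgue_measure R \x @lebesgue_measure R)%E S.

Definition mble S : Prop :=
  measurable (S : set (measurableTypeR R * measurableTypeR R)).

Lemma area_le S S' : mble S -> mble S' -> S `<=` S' -> (area S <= area S')%E.
Proof. by move=> h h' SS'; apply: le_measure => //; rewrite inE. Qed.

Lemma areaU S S' : mble S -> mble S' -> S `&` S' = set0 ->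
  area (S `|` S') = (area S + area S')%E.
Proof. by move=> h h' e; rewrite /area measureU. Qed.

Lemma areaU_le S S' : mble S -> mble S' -> (area (S `|` S') <= area S + area S')%E.
Proof. by move=> h h'; rewrite /area; apply: measureU2. Qed.

Lemma mbleU S S' : mble S -> mble S' -> mble (S `|` S').
Proof. exact: measurableU. Qed.

Lemma mble_bigU n (F : 'I_n -> set (R * R)) :
  (forall i, mble (F i)) -> mble (\big[setU/set0]_(i < n) F i).
Proof. by move=> h; apply: bigsetU_measurable => i _; exact: h. Qed.

Lemma area_bigU n (F : 'I_n -> set (R * R)) : (forall i, mble (F i)) ->
  (forall (i j : 'I_n) z, (i < j)%N -> F i z -> F j z -> False) ->
  area (\big[setU/set0]_(i < n) F i) = (\sum_(i < n) area (F i))%E.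
Proof.
move=> mF dF; apply: measure_bigsetU_ord => // i j _ _ [z [zi zj]].
apply: val_inj => /=; have [ij|ij|//] := ltngtP i j; exfalso; [exact: dF zi zj|exact: dF zj zi].
Qed.

Lemma area_bigU_le n (F : 'I_n -> set (R * R)) : (forall i, mble (F i)) ->
  (area (\big[setU/set0]_(i < n) F i) <= \sum_(i < n) area (F i))%E.
Proof.
elim: n F => [|n IH] F mF; first by rewrite !big_ord0 /area measure0.
rewrite !big_ord_recr /=; apply: le_trans (areaU_le _ _) _ => //.
  by apply: mble_bigU => i.
by rewrite leeD2r // IH.
Qed.

Lemma setX_mble (I J : interval R) : mble ([set` I] `*` [set` J]).
Proof. by apply: measurableX; exact: measurable_itv. Qed.

Lemma area_setX (b0 b1 b2 b3 : bool) (x1 x2 y1 y2 : R) : x1 <= x2 -> y1 <= y2 ->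
  area ([set` Interval (BSide b0 x1) (BSide b1 x2)] `*`
        [set` Interval (BSide b2 y1) (BSide b3 y2)]) = ((x2 - x1) * (y2 - y1))%:E.
Proof.
move=> hx hy; rewrite /area product_measure1E; try exact: measurable_itv.
suff L (b b' : bool) (x y : R) : x <= y ->
    lebesgue_measure [set` Interval (BSide b x) (BSide b' y)] = (y - x)%:E.
  by rewrite EFinM;
    exact: (congr2 (fun x y : \bar R => (x * y)%E) (L b0 b1 _ _ hx) (L b2 b3 _ _ hy)).
move=> xy; rewrite lebesgue_measure_itv /= lte_fin.
case: ltrP => h; first by rewrite EFinB.
have -> : y = x by lra.
by rewrite subrr.
Qed.

Lemma ofrect_area a u (x1 x2 y1 y2 : R) : unitv u -> x1 <= x2 -> y1 <= y2 ->
  mble (ofrect a u x1 x2 y1 y2) /\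
  area (ofrect a u x1 x2 y1 y2) = ((x2 - x1) * (y2 - y1))%:E.
Proof.
move=> hu hx hy.
suff [X [X' [Y [Y' [hX hY hA e]]]]] : exists X X' Y Y', [/\ X <= X', Y <= Y',
    (X' - X) * (Y' - Y) = (x2 - x1) * (y2 - y1) &
    ofrect a u x1 x2 y1 y2 = [set` `]X, X'[] `*` [set` `]Y, Y'[]].
  by rewrite e -hA; split; [exact: setX_mble|exact: area_setX].
case: hu => [->|[->|[->|->]]]; [exists (a.1 + x1), (a.1 + x2), (a.2 + y1), (a.2 + y2)
 |exists (a.1 - x2), (a.1 - x1), (a.2 - y2), (a.2 - y1)
 |exists (a.1 - y2), (a.1 - y1), (a.2 + x1), (a.2 + x2)
 |exists (a.1 + y1), (a.1 + y2), (a.2 - x2), (a.2 - x1)];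
 (split; [lra|lra|ring|]); apply/seteqP; split => z;
 rewrite /ofrect /along /across /= !in_itv /= => -[h1 h2]; split; lra.
Qed.

Lemma frect_area a u (x1 x2 y1 y2 : R) : unitv u -> x1 <= x2 -> y1 <= y2 ->
  mble (frect a u x1 x2 y1 y2) /\
  area (frect a u x1 x2 y1 y2) = ((x2 - x1) * (y2 - y1))%:E.
Proof.
move=> hu hx hy.
suff [X [X' [Y [Y' [hX hY hA e]]]]] : exists X X' Y Y', [/\ X <= X', Y <= Y',
    (X' - X) * (Y' - Y) = (x2 - x1) * (y2 - y1) &
    frect a u x1 x2 y1 y2 = [set` `[X, X']] `*` [set` `[Y, Y']]].
  by rewrite e -hA; split; [exact: setX_mble|exact: area_setX].
case: hu => [->|[->|[->|->]]]; [exists (a.1 + x1), (a.1 + x2), (a.2 + y1), (a.2 + y2)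
 |exists (a.1 - x2), (a.1 - x1), (a.2 - y2), (a.2 - y1)
 |exists (a.1 - y2), (a.1 - y1), (a.2 + x1), (a.2 + x2)
 |exists (a.1 + y1), (a.1 + y2), (a.2 - x2), (a.2 - x1)];
 (split; [lra|lra|ring|]); apply/seteqP; split => z;
 rewrite /frect /along /across /= !in_itv /= => -[h1 h2]; split; lra.
Qed.

Definition axis_length (s : seq (R * R)) : R := \sum_(i < (size s).-1) seglen s i.

Section Strip.
Variables (t d0 d1 : R) (s : seq (R * R)).
Hypotheses (t_gt0 : 0 < t) (axs : strip_axis t s) (d0_ge0 : 0 <= d0) (d1_ge0 : 0 <= d1).

(* Attaching each corner square to the straight piece that leaves it cuts the
   strip into rectangles that overlap only along edges. *)
Let lo i : R := if i == 0%N then d0 else - (t / 2).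
Let up i : R := seglen s i - (if i.+2 == size s then d1 else t / 2).
Hypothesis lo_up : forall i, (i.+1 < size s)%N -> lo i <= up i.

Let t_ge0 : 0 <= t. Proof. exact: ltW. Qed.
Let E (i : nat) : set (R * R) := ofrect s`_i (udir s i) (lo i) (up i) (- (t / 2)) (t / 2).
Let F (i : nat) : set (R * R) := frect s`_i (udir s i) (lo i) (up i) (- (t / 2)) (t / 2).

Let idx (i : 'I_(size s).-1) : (i.+1 < size s)%N.
Proof. by have := ltn_ord i; rewrite ltn_predRL. Qed.

Let sumE : \sum_(i < (size s).-1) (up i - lo i) * t = (axis_length s - d0 - d1) * t.
Proof.
rewrite -mulr_suml; congr (_ * _); rewrite /axis_length.
have s1 : (1 < size s)%N by case: axs.
(* At an inner vertex, what one segment loses by the cut the next one gains, so the differences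
   telescope and only the two ends contribute. *)
pose g i : R := if i == 0%N then - d0 else if i.+1 == size s then d1 else t / 2.
have e : \sum_(i < (size s).-1) (seglen s i - (up i - lo i)) = g (size s).-1 - g 0%N.
  rewrite -(big_mkord xpredT (fun i => seglen s i - (up i - lo i))).
  apply: telescope_sumr_eq => // k hk; rewrite /up /lo /g /=.
  have -> : (k.+1 == size s) = false by lia.
  by case: (k == 0)%N; case: (_ == size s); lra.
have g0 : g 0%N = - d0 by [].
have g1 : g (size s).-1 = d1.
  have hs : (size s).-1.+1 = size s by lia.
  have hs0 : ((size s).-1 == 0)%N = false by lia.
  by rewrite /g hs hs0 eqxx.
move: e; rewrite g0 g1 big_split /= sumrN => e.
lra.
Qed.

(** Open cells are disjoint and bound the area from below. They also lie in the interior of the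
    tube, which later makes them disjoint from the next island. *)
Lemma open_cells_area : exists P, [/\ mble P, area P = ((axis_length s - d0 - d1) * t)%:E &
  P `<=` mint (tube t s d0 d1)].
Proof.
have t0 := t_gt0; have h0 := d0_ge0; have h1 := d1_ge0.
have tt : 0 <= t <= t by rewrite t_ge0 lexx.
have inc i z : E i z -> cell t s d0 d1 i z.
  rewrite /E /lo /up /cell => -[k1 k2]; split; last by lra.
  by move: k1; case: (i == 0)%N; case: (_ == size s); lra.
have inc0 i z : E i z -> cell t s 0 0 i z.
  rewrite /E /lo /up /cell => -[k1 k2]; split; last by lra.
  by move: k1; case: (i == 0)%N; case: (_ == size s); lra.
have hE i : (i.+1 < size s)%N -> mble (E i) /\ area (E i) = ((up i - lo i) * t)%:E.
  move=> hi; have ui := udir_unitv t_ge0 axs hi.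
  have [||? ->] := @ofrect_area s`_i (udir s i) (lo i) (up i) (- (t / 2)) (t / 2) ui.
  - exact: lo_up.
  - lra.
  by split => //; congr (_ * _)%:E; lra.
exists (\big[setU/set0]_(i < (size s).-1) E i); split.
- by apply: mble_bigU => i; have [] := hE _ (idx i).
- have mE (i : 'I_(size s).-1) : mble (E i) by have [] := hE _ (idx i).
  rewrite (area_bigU mE) => [|i j z ij zi zj].
    rewrite -sumE -sumEFin; apply: eq_bigr => i _; by have [_ ->] := hE _ (idx i).
  have hi := idx i; have hj := idx j.
  have [ij1|ij1] := eqVneq (i.+1) j.
    rewrite -ij1 in hj; have [sg hsg /(_ z) [e1 e2]] := turn t_ge0 axs hj.
    move: zi zj; rewrite -ij1 => -[k1 _] -[_ k2].
    move: k1 e2 k2; rewrite /up (ltn_eqF hj).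
    by case: hsg => ->; lra.
  have [_ _ _ _ h] := axs.
  have : (piece t s i `&` piece t s j) z.
    by rewrite !(piece_cell t_ge0 axs tt) //; split; apply: inc0.
  by rewrite h // ltn_neqAle ij1.
- rewrite -bigcup_mkord => z [i /=]; rewrite ltn_predRL => hi zi.
  have ui := udir_unitv t_ge0 axs hi.
  by have := ofrect_int ui zi; apply: mintS => y /inc hy; exists i.
Qed.

(** A point of a cell beyond [up i] is in the corner square, which the next closed cell contains. *)
Lemma tube_area_le : d0 = 0 -> d1 = 0 -> mble (tube t s 0 0) /\
  (area (tube t s 0 0) <= (axis_length s * t)%:E)%E.
Proof.
have t0 := t_gt0; move=> d00 d10.
have hF i : (i.+1 < size s)%N -> mble (F i) /\ area (F i) = ((up i - lo i) * t)%:E.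
  move=> hi; have ui := udir_unitv t_ge0 axs hi.
  have [||? ->] := @frect_area s`_i (udir s i) (lo i) (up i) (- (t / 2)) (t / 2) ui.
  - exact: lo_up.
  - lra.
  by split => //; congr (_ * _)%:E; lra.
have eU : tube t s 0 0 = \big[setU/set0]_(i < (size s).-1) F i.
  rewrite -bigcup_mkord; apply/seteqP; split => z.
    move=> [i hi hz].
    have hio : (i < (size s).-1)%N by rewrite ltn_predRL.
    have [k|k] := lerP (along s`_i (udir s i) z) (up i).
      exists i => //; move: hz k; rewrite /F /cell /frect /lo d00 /=.
      by case: (i == 0)%N => -[h1 h2] k; split; lra.
    have hi2 : (i.+2 < size s)%N.
      rewrite ltn_neqAle hi andbT; apply/negP => e.
      by move: hz k; rewrite /cell /frect /up d10 /= e => -[h1 h2]; lra.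
    have hio2 : (i.+1 < (size s).-1)%N by rewrite ltn_predRL.
    exists i.+1 => //=.
    have [sg hsg /(_ z) [e1 e2]] := turn t_ge0 axs hi2.
    have l2 := lo_up hi2.
    have l3 := seglen_gt axs hi2.
    have c1 : corner s i.+1 by rewrite /corner ltn_predRL.
    move: hz k l3 l2; rewrite /F /cell /frect /lo /up d10 /= (ltn_eqF hi2) c1 e1 e2 => -[h1 h2] k.
    rewrite (corner_ends hi2).2.
    by case: (i.+3 == size s) hsg => /= -[->|->] l3 l2; split; lra.
  move=> [i /=]; rewrite ltn_predRL => hi [h1 h2]; exists i => //.
  split; last by lra.
  move: h1; rewrite /lo /up d00 d10.
  by case: (i == 0)%N; case: (_ == size s); lra.
rewrite eU; split; first by apply: mble_bigU => i; have [] := hF _ (idx i).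
apply: le_trans (area_bigU_le _) _; first by move=> i; have [] := hF _ (idx i).
have := sumE; rewrite d00 d10 !subr0 => <-.
rewrite -sumEFin; apply: lee_sum => i _; by have [_ ->] := hF _ (idx i).
Qed.

End Strip.

End Area.
Section StripArea.
Context {R : realType}.
Implicit Types (s : seq (R * R)) (w t : R).

Lemma strip_area w s : 0 < w -> strip_axis w s ->
  mble (strip w s) /\ area (strip w s) = (axis_length s * w)%:E.
Proof.
move=> w0 axs; have w0' := ltW w0.
have lu i : (i.+1 < size s)%N ->
    (if i == 0%N then 0 else - (w / 2)) <= seglen s i - (if i.+2 == size s then 0 else w / 2).
  move=> hi; have := seglen_gt axs hi; have [-> ->] := corner_ends hi.
  by case: (i == 0)%N; case: (_ == size s) => /=; lra.
have -> : strip w s = tube w s 0 0 by apply: strip_tube axs _; rewrite ?w0' ?lexx.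
have [m1 a1] := tube_area_le w0 axs (lexx 0) (lexx 0) lu erefl erefl.
have [P [mP aP PS]] := open_cells_area w0 axs (lexx 0) (lexx 0) lu.
split => //; apply/eqP; rewrite eq_le a1 /=.
apply: le_trans (area_le mP m1 _); first by rewrite aP !subr0.
by move=> z /PS /mint_sub.
Qed.

Lemma thin_tube_area t s d0 d1 : 0 < t -> strip_axis (3 * t) s -> (2 < size s)%N ->
  0 <= d0 <= t -> 0 <= d1 <= t ->
  exists P, [/\ mble P, area P = ((axis_length s - d0 - d1) * t)%:E &
    P `<=` mint (tube t s d0 d1)].
Proof.
move=> t0 axs s2 h0 h1; have w0 : 0 <= 3 * t by lra.
have tw : 0 <= t <= 3 * t by lra.
apply: (open_cells_area t0 (strip_axisS w0 axs tw)); [lra|lra|].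
move=> i hi; have [l1 l2] := seglen_lb t0 axs s2 hi.
have iN := two_ends i s2.
move: l2 iN; rewrite lt0n (ltn_neqAle i.+2) hi andbT.
by case: (i == 0)%N; case: (_ == size s) => //= l2 _; first [lra|have := l2 isT isT; lra].
Qed.

Lemma thin_strip_area t s : 0 < t -> strip_axis (3 * t) s ->
  mble (tube t s 0 0) /\ area (tube t s 0 0) = (axis_length s * t)%:E.
Proof.
move=> t0 axs; have w0 : 0 <= 3 * t by lra.
have tw : 0 <= t <= 3 * t by lra.
have := strip_area t0 (strip_axisS w0 axs tw).
by rewrite (strip_tube w0 axs tw).
Qed.

Lemma foot_frect t s i x eta p q : 0 < t -> strip_axis (3 * t) s ->
  foot_at t s i x eta p q ->
  band t p q = frect s`_i (udir s i) (x - t / 2) (x + t / 2)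
    (if 0 < eta then 0 else - (3 * t / 2)) (if 0 < eta then 3 * t / 2 else 0).
Proof.
move=> t0 axs hf; rewrite (foot_bandE t0 axs hf); have [_ _ heta _ _] := hf.
apply/seteqP; split => z; rewrite /frect /=; case: heta => ->.
- by rewrite ltr01 => -[h1 h2]; split; lra.
- have -> : (0 < -1 :> R) = false by apply/negbTE; rewrite -leNgt; lra.
  by move=> -[h1 h2]; split; lra.
- by rewrite ltr01 => -[h1 h2]; split; lra.
- have -> : (0 < -1 :> R) = false by apply/negbTE; rewrite -leNgt; lra.
  by move=> -[h1 h2]; split; lra.
Qed.

Lemma foot_band_area t s i x eta p q : 0 < t -> strip_axis (3 * t) s ->
  foot_at t s i x eta p q ->
  mble (band t p q) /\ area (band t p q) = (3 / 2 * t * t)%:E.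
Proof.
move=> t0 axs hf; rewrite (foot_frect t0 axs hf).
have [hi hx heta _ _] := hf.
have w0 : 0 <= 3 * t by lra.
have ui := udir_unitv w0 axs hi.
have [||? ->] := @frect_area _ s`_i (udir s i) (x - t / 2) (x + t / 2)
    (if 0 < eta then 0 else - (3 * t / 2)) (if 0 < eta then 3 * t / 2 else 0) ui.
- lra.
- by case: ifP => _; lra.
by split => //; congr EFin; case: ifP => _; lra.
Qed.

End StripArea.

(** * Islands and canals as sets: closures, interiors and coordinates *)

Section Canals.
Context {R : realType}.
Implicit Types (z y p q : R * R) (n m : nat).
Variables (C : nat -> set (R * R)) (A : nat -> seq (R * R)).
Hypothesis hC : cantor_canals C A.

Local Notation t n := (land_width R n).
Local Notation Q := (@unit_square R).

Lemma land_gt0 n : 0 < t n.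
Proof. by rewrite /land_width invr_gt0 exprn_gt0. Qed.

Lemma landS n : t n = 3 * t n.+1.
Proof. by rewrite /land_width exprS invfM mulrA divff ?mul1r // pnatr_eq0. Qed.

Lemma land_prev n : (0 < n)%N -> t n.-1 = 3 * t n.
Proof. by case: n => // n _; exact: landS. Qed.

Lemma land0 : t 0 = 1. Proof. by rewrite /land_width expr0 invr1. Qed.

Lemma land1 : t 1 = 1 / 3. Proof. by have := landS 0; rewrite land0; lra. Qed.

Lemma axis_ok n : (0 < n)%N -> strip_axis (t n) (A n).
Proof. by case: hC => _ h _ _ _ /h[]. Qed.

Lemma islandE n : (0 < n)%N -> island C n = strip (t n) (A n).
Proof. by case: hC => _ h _ _ _ /h[]. Qed.

Lemma islandP n z : island C n z <-> forall r, 0 < r ->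
  exists y, [/\ nbd z r y, Q y & forall m, (0 < m <= n)%N -> ~ C m y].
Proof.
rewrite /island; split=> [/closureP h r /h[y zy [Qy nC]]|h].
  by exists y; split => // m mn Cy; apply: nC; exists m.
apply/closureP => r /h[y [zy Qy nC]]; exists y => //; split => // -[m mn].
exact: nC.
Qed.

Lemma unit_squareE : Q = frect (0, 0) (1, 0) 0 1 0 1.
Proof.
by apply/seteqP; split => z; rewrite /unit_square /frect /along /across /= => -[h1 h2];
  split; lra.
Qed.

Lemma unitv10 : unitv ((1, 0) : R * R). Proof. by left. Qed.

Lemma island_unit_square n : island C n `<=` Q.
Proof.
move=> z /islandP h; apply: contrapT; rewrite unit_squareE => /(frect_co_open unitv10)[r r0 k].
by have [y [/k + Qy _]] := h _ r0; rewrite -unit_squareE.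
Qed.

Lemma island_outside n z : Q z -> (forall m, (0 < m <= n)%N -> ~ C m z) -> island C n z.
Proof. by move=> Qz nC; apply/islandP => r r0; exists z; split => //; exact: nbd_id. Qed.

Lemma island_le n m : (n <= m)%N -> island C m `<=` island C n.
Proof.
move=> nm z /islandP h; apply/islandP => r /h[y [zy Qy nC]]; exists y; split => // k /andP[k0 kn].
by apply: nC; rewrite k0 (leq_trans kn).
Qed.

Lemma island_mint n m z : (0 < m <= n)%N -> island C n z -> mint (C m) z -> False.
Proof.
move=> mn /islandP h [r r0 zr]; have [y [/zr Cy _ nC]] := h _ r0.
exact: nC Cy.
Qed.

(** A canal through an interior point of the island would have interior points of its own on the
    island, but the island is the closure of undug land. *)
Lemma mint_island n m z : (0 < m <= n)%N -> mint_dense (C m) -> mint (island C n) z -> ~ C m z.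
Proof.
move=> mn fC [r r0 zr] Cz; have [y zy Cy] := fC _ _ Cz r0.
by apply: island_mint mn _ Cy; exact: zr.
Qed.

(** As the new canal is closed, undug points close enough to a point off it stay undug. *)
Lemma island_step n : co_open (C n.+1) -> island C n `<=` island C n.+1 `|` C n.+1.
Proof.
move=> fC z hz; have [|/fC[r r0 k]] := pselect (C n.+1 z); [by right|left].
apply/islandP => r' r'0; move/islandP: hz => /(_ (Num.min r r')).
rewrite lt_min r0 r'0 => /(_ isT)[y [zy Qy nC]]; exists y; split => //.
  by apply: nbdS zy; rewrite ge_min lexx orbT.
move=> m /andP[m0]; rewrite leq_eqVlt => /orP[/eqP ->|mn].
  by apply: k; apply: nbdS zy; rewrite ge_min lexx.
by apply: nC; rewrite m0.
Qed.

Lemma canal1E : C 1%N = frect (0, 0) (1, 0) 0 (2 / 3) (1 / 3) (2 / 3).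
Proof.
case: hC => -> _ _ _ _.
by apply/seteqP; split => z; rewrite /frect /along /across /= => -[h1 h2];
  split; lra.
Qed.

(* [canal_axis] in the coordinates of the island on the previous day. *)
Lemma canalE n : (1 < n)%N -> (2 < size (A n.-1))%N ->
  strip_axis (3 * t n) (A n.-1) /\
  if (n <= 3)%N then C n = tube (t n) (A n.-1) 0 (t n)
  else exists p q, [/\ peak A (n - 3) p, foot (3 * t n) (A n.-1) p q &
    C n = tube (t n) (A n.-1) (t n) (t n) `|` band (t n) p q].
Proof.
move=> n1 s2.
have t0 := land_gt0 n.
have tn : t n.-1 = 3 * t n by apply: land_prev; exact: ltnW.
have axs : strip_axis (3 * t n) (A n.-1) by rewrite -tn; apply: axis_ok; case: n n1 s2 t0 tn => [|[|]].
have w0 : 0 <= 3 * t n by lra.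
split => //.
have tub d0 s' : 0 <= d0 <= t n -> size s' = size (A n.-1) ->
  (forall i, (i < size (A n.-1))%N -> s'`_i =
     if i == 0%N then pt (A n.-1)`_0 (udir (A n.-1) 0) d0 0
     else if i.+1 == size (A n.-1) then pt (A n.-1)`_i (udir (A n.-1) i.-1) (- t n) 0
     else (A n.-1)`_i) -> strip (t n) s' = tube (t n) (A n.-1) d0 (t n).
  by move=> hd ss hs; apply: (tube_shorten w0 axs) => //; lra.
case: ifP => n3.
  case: hC => _ _ _ h _; rewrite h ?n1 ?n3 // /canal_axis n3.
  apply: tub; [lra|exact: size_trim_last|].
  move=> i hi; rewrite nth_trim_last ?(ltnW s2) //.
  case: (eqVneq i 0%N) => [->|//].
  by rewrite (ltn_eqF (ltnW s2)) /pt; case: (_`_0) => a b /=; congr (_, _); lra.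
case: hC => _ _ _ _ h; have [|p [q [hp hf e]]] := h n; first by rewrite ltnNge n3.
exists p, q; split => //; first by rewrite -tn.
rewrite e; congr (_ `|` _); rewrite /canal_axis n3.
apply: tub; [lra|by rewrite size_trim_head size_trim_last|].
move=> i hi; rewrite nth_trim_head ?size_trim_last ?(ltnW s2) //.
case: (eqVneq i 0%N) => [i0|//]; last by rewrite nth_trim_last // ltnW.
have s1 := ltnW s2; have s0 := ltnW s1.
rewrite /udir !nth_trim_last //.
by rewrite (ltn_eqF (ltnW s2)) (ltn_eqF s2).
Qed.

(** The existence of a corner is still a hypothesis here: it will follow from the lower bound of the
    lengths, whose proof uses this lemma. *)
Lemma canal_reg n : (0 < n)%N -> ((1 < n)%N -> (2 < size (A n.-1))%N) ->
  co_open (C n) /\ mint_dense (C n).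
Proof.
case: n => // -[|n] _ hs.
  rewrite canal1E; split; first by apply: frect_co_open; left.
  by apply: frect_mint_dense; [left|lra|lra].
have s2 := hs isT; have [axs] := canalE (n := n.+2) isT s2.
have t0 := land_gt0 n.+2; have w0 : 0 <= 3 * t n.+2 by lra.
case: ifP => _ => [->|[p [q [_ hf ->]]]].
  by split; [apply: tube_co_open axs _ _ _|apply: tube_mint_dense => //; lra].
have [i [x [eta ha]]] := footP t0 axs hf.
have [ar fa] : co_open (band (t n.+2) p q) /\ mint_dense (band (t n.+2) p q).
  rewrite (foot_frect t0 axs ha); have [hi hx heta _ _] := ha.
  have ui := udir_unitv w0 axs hi.
  split; first exact: frect_co_open.
  by apply: frect_mint_dense => //; [lra|case: ifP => _; lra].
split; [apply: co_openU|apply: mint_denseU] => //.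
  by apply: tube_co_open axs _ _ _.
by apply: tube_mint_dense => //; lra.
Qed.

End Canals.

(** * The length of the island axis doubles every day, up to a small error *)

Section Lengths.
Context {R : realType}.
Implicit Types (z y p q : R * R) (n m : nat).
Variables (C : nat -> set (R * R)) (A : nat -> seq (R * R)).
Hypothesis hC : cantor_canals C A.

Local Notation t n := (land_width R n).
Local Notation Q := (@unit_square R).
Local Notation L n := (axis_length (A n)).

Let t0 n : 0 < t n. Proof. exact: land_gt0. Qed.

Lemma island_area n : (0 < n)%N ->
  mble (island C n) /\ area (island C n) = (L n * t n)%:E.
Proof.
by move=> n0; rewrite (islandE hC n0); apply: strip_area (axis_ok hC n0).
Qed.

Lemma unit_square_area : mble Q /\ area Q = 1%:E.
Proof.
rewrite unit_squareE; have [||m a] := @frect_area R (0, 0) (1, 0) 0 1 0 1 unitv10; [lra|lra|].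
by split => //; rewrite a; congr EFin; lra.
Qed.

(** A straight axis joins two points of the unit square, so its length is at most 1. *)
Lemma size_axis n : (0 < n)%N -> 1 < L n -> (2 < size (A n))%N.
Proof.
move=> n0 L1; have axs := axis_ok hC n0.
have s1 : (1 < size (A n))%N by case: axs.
rewrite ltnNge; apply/negP => s2.
have sz : size (A n) = 2%N by apply/eqP; rewrite eqn_leq s2.
have w0 := ltW (t0 n).
have ww : 0 <= t n <= t n by rewrite w0 lexx.
have u1 := udir_unitv w0 axs s1; have l0 := seglen_gt0 w0 axs s1.
have inQ (x : R) : 0 <= x <= seglen (A n) 0 -> Q (pt (A n)`_0 (udir (A n) 0) x 0).
  move=> hx; apply: (@island_unit_square _ C n); rewrite (islandE hC n0) (strip_tube w0 axs ww).
  exists 0%N => //; rewrite /cell /frect /= along_pt // across_pt // sz /=.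
  by have := t0 n; split; lra.
have q0 := inQ 0; have q1 := inQ (seglen (A n) 0).
move: L1; rewrite /axis_length sz /= big_ord1 => L1.
have {}q0 : Q (pt (A n)`_0 (udir (A n) 0) 0 0) by apply: q0; lra.
have {}q1 : Q (pt (A n)`_0 (udir (A n) 0) (seglen (A n) 0) 0) by apply: q1; lra.
move: q0 q1 L1; rewrite /unit_square /pt.
by case: u1 => [->|[->|[->|->]]] /=; lra.
Qed.

(** The first island has area [L 1 / 3], which lies between [1 - 2 / 9] and 1. *)
Lemma length1 : 7 / 3 <= L 1 <= 3.
Proof.
have [mI aI] := @island_area 1 isT; have [mQ aQ] := unit_square_area.
rewrite land1 in aI.
apply/andP; split; last first.
  have := area_le mI mQ (@island_unit_square _ C 1).
  by rewrite aI aQ lee_fin; lra.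
have fC : co_open (C 1%N) by rewrite (canal1E hC); apply: frect_co_open; left.
have [||mC aC] := @frect_area R (0, 0) (1, 0) 0 (2 / 3) (1 / 3) (2 / 3) unitv10; [lra|lra|].
rewrite -(canal1E hC) in mC aC.
have sub : Q `<=` island C 1 `|` C 1%N.
  move=> z Qz; apply: (island_step fC); apply: island_outside => // m.
  by case: m.
have := le_trans (area_le mQ (mbleU mI mC) sub) (areaU_le mI mC).
by rewrite aQ aI aC -EFinD lee_fin; lra.
Qed.

(** The island is covered by the next island, the untrimmed canal tube and the connecting band; the
    areas are compared and divided by [t n.+1]. *)
Lemma length_lower n : (0 < n)%N -> (2 < size (A n))%N ->
  2 * L n - 3 / 2 * t n.+1 <= L n.+1.
Proof.
move=> n0 s2; have [axs hn] := canalE hC (n := n.+1) n0 s2.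
have [fC _] := canal_reg hC (n := n.+1) isT (fun=> s2).
have tt := t0 n.+1.
have [mI aI] := island_area n0; have [mI' aI'] := @island_area n.+1 isT.
have [mT aT] := thin_strip_area tt axs.
(* [B] is the connecting band, and is empty on Days 2 and 3. *)
have [B [mB aB CB]] : exists B, [/\ mble B, (area B <= (3 / 2 * t n.+1 * t n.+1)%:E)%E &
    C n.+1 `<=` tube (t n.+1) (A n) 0 0 `|` B].
  have sub d0 d1 : 0 <= d0 -> 0 <= d1 ->
      tube (t n.+1) (A n) d0 d1 `<=` tube (t n.+1) (A n) 0 0.
    move=> h0 h1 z [i hi [k1 k2]]; exists i => //; split; last exact: k2.
    by move: k1; case: (i == 0)%N; case: (_ == size _); lra.
  move: hn; case: ifP => _ => [->|[p [q [_ hf ->]]]].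
    exists set0; split; first exact: measurable0.
      rewrite /area measure0 lee_fin; apply: mulr_ge0; last exact: ltW.
      by apply: mulr_ge0; [lra|exact: ltW].
    by move=> z hz; left; apply: sub hz; lra.
  have [i [x [eta ha]]] := footP tt axs hf.
  have [mB aB] := foot_band_area tt axs ha.
  exists (band (t n.+1) p q); split => //; first by rewrite aB.
  by move=> z [hz|hz]; [left; apply: sub hz; lra|right].
have sub : island C n `<=` island C n.+1 `|` (tube (t n.+1) (A n) 0 0 `|` B).
  by move=> z /(island_step fC)[|/CB]; [left|right].
have mTB := mbleU mT mB.
have := le_trans (area_le mI (mbleU mI' mTB) sub) (areaU_le mI' mTB).
move=> /le_trans/(_ (leeD2l _ (le_trans (areaU_le mT mB) (leeD2l _ aB)))).
rewrite aI aI' aT -!EFinD lee_fin (landS n) => h.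
have : 0 <= t n.+1 * (L n.+1 - 2 * L n + 3 / 2 * t n.+1) by lra.
by rewrite pmulr_rge0 //; lra.
Qed.

(** The open cells of the trimmed canal and the next island are disjoint parts of the island, and
    trimming shortens the canal by at most [2 * t n.+1]. *)
Lemma length_upper n : (0 < n)%N -> (2 < size (A n))%N ->
  L n.+1 <= 2 * L n + 2 * t n.+1.
Proof.
move=> n0 s2; have [axs hn] := canalE hC (n := n.+1) n0 s2.
have tt := t0 n.+1.
have [mI aI] := island_area n0; have [mI' aI'] := @island_area n.+1 isT.
have [d0 [hd0 hT]] : exists d0, 0 <= d0 <= t n.+1 /\
    tube (t n.+1) (A n) d0 (t n.+1) `<=` C n.+1.
  move: hn; case: ifP => _ => [->|[p [q [_ hf ->]]]]; first by exists 0; split => //; lra.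
  by exists (t n.+1); split; [lra|move=> z; left].
have h1 : 0 <= t n.+1 <= t n.+1 by lra.
have [P [mP aP PT]] := thin_tube_area tt axs s2 hd0 h1.
have PI : island C n.+1 `&` P = set0.
  apply/seteqP; split => // z [zI /PT zT].
  apply: (@island_mint _ C n.+1 n.+1 z _ zI) => //; first by rewrite ltnS leqnn.
  exact: mintS zT.
have PS : island C n.+1 `|` P `<=` island C n.
  move=> z [|/PT/mint_sub zT]; first exact: island_le.
  rewrite (islandE hC n0) (landS n); apply: tubeS zT => //; lra.
have := area_le (mbleU mI' mP) mI PS.
rewrite areaU // aI aI' aP -EFinD lee_fin (landS n) => h.
have : 0 <= t n.+1 * (2 * L n + d0 + t n.+1 - L n.+1) by lra.
by rewrite pmulr_rge0 //; lra.
Qed.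

Lemma land_le n : (0 < n)%N -> t n <= 1 / 3.
Proof.
move=> n0; rewrite -land1 /land_width lef_pV2 ?posrE ?exprn_gt0 //.
by rewrite ler_eXn2l // ltr1n.
Qed.

(** The summand 2 absorbs the error [3 / 2 * t n.+2], which is at most 1 / 2, and keeps the length
    above 1, so that [size_axis] provides the corner needed for the next step. *)
Lemma length_ge n : (0 < n)%N -> 2 + 2 ^+ n / 6 <= L n.
Proof.
elim: n => // -[_ _|n IH _]; first by have := length1; rewrite expr1; lra.
have {}IH := IH isT.
have p2 : 0 < 2 ^+ n.+1 :> R by rewrite exprn_gt0.
have := @length_lower n.+1 isT (@size_axis n.+1 isT _).
have := @land_le n.+2 isT; rewrite (exprS _ n.+1) => h1 h2.
by have := h2 ltac:(lra); lra.
Qed.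

Lemma axis_size n : (0 < n)%N -> (2 < size (A n))%N.
Proof.
move=> n0; apply: size_axis => //; have := length_ge n0.
have : 0 < 2 ^+ n :> R by rewrite exprn_gt0.
by lra.
Qed.

Lemma length_le n : (0 < n)%N -> L n <= 3 * 2 ^+ n.
Proof.
(* The added 2 doubles along with the length and so absorbs the error, which is at most 2 / 3. *)
suff h k : L k.+1 + 2 <= 3 * 2 ^+ k.+1 by case: n => // n _; have := h n; lra.
elim: k => [|k IH]; first by have := length1; rewrite expr1; lra.
have := @length_upper k.+1 isT (@axis_size k.+1 isT).
by have := @land_le k.+2 isT; rewrite (exprS _ k.+1); lra.
Qed.

Lemma canal_co_open n : (0 < n)%N -> co_open (C n).
Proof.
by move=> n0; have [] := canal_reg hC n0 _ => // n1; apply: axis_size; case: n n1 {n0} => [|[]].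
Qed.

Lemma canal_mint_dense n : (0 < n)%N -> mint_dense (C n).
Proof.
by move=> n0; have [] := canal_reg hC n0 _ => // n1; apply: axis_size; case: n n1 {n0} => [|[]].
Qed.

End Lengths.
(** * Canals of different colours are disjoint *)

Section Tips.
Context {R : realType}.
Implicit Types (z p q nu : R * R) (n m i j : nat) (s : seq (R * R)).

Lemma good_foot_rev (t : R) s i j (x eta : R) p q nu :
  0 < t -> strip_axis (3 * t) s -> (2 < size s)%N -> (i + j).+2 = size s ->
  good_foot t s i x eta p q nu -> good_foot t (rev s) j (seglen s i - x) (- eta) p q nu.
Proof.
move=> t0 axs s2 ij [hf e h0 h1].
have ji : (j + i).+2 = size s by rewrite addnC.
have w0 : 0 <= 3 * t by lra.
have [e1 e2 _] := frame_rev w0 axs ji.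
split; first exact: (foot_rev t0 axs s2 ij hf).
- by rewrite e e1 /=; congr (_, _); lra.
- by move=> j0; have := h1 _; rewrite -ij j0 addn0 => /(_ erefl); lra.
- rewrite size_rev e2 => jl; have i0 : i = 0%N by lia.
  by have := h0 i0; lra.
Qed.

(** The last end is expressed as a first end of the reversed axis, so that [tip_end] serves both
    tips. *)
Lemma canal_axis_last (A : nat -> seq (R * R)) n : (2 < size (A n.-1))%N ->
  last 0 (canal_axis A n) =
  pt (rev (A n.-1))`_0 (udir (rev (A n.-1)) 0) (land_width R n) 0.
Proof.
move=> s2; set s := A n.-1 in s2 *.
have s1 := ltnW s2; have s0 := ltnW s1.
have sp : (size s).-1.+1 = size s by rewrite prednK.
have sp0 : ((size s).-1 == 0)%N = false by rewrite -subn1 subn_eq0 leqNgt s1.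
have -> : last 0 (canal_axis A n) = (trim_last (land_width R n) s)`_(size s).-1.
  rewrite /canal_axis -/s -nth_last; case: ifP => _; rewrite ?size_trim_head size_trim_last //.
  by rewrite nth_trim_head ?size_trim_last // sp0.
rewrite nth_trim_last // ?sp // eqxx /udir !rev_nth // subn1.
have -> : (size s - 2 = (size s).-2)%N by rewrite subn2.
have e : (size s).-2.+1 = (size s).-1 by lia.
by rewrite e directionC /pt /=; congr (_, _); lra.
Qed.

Lemma canal_axis_head (A : nat -> seq (R * R)) n : (3 < n)%N -> (2 < size (A n.-1))%N ->
  head 0 (canal_axis A n) = pt (A n.-1)`_0 (udir (A n.-1) 0) (land_width R n) 0.
Proof.
move=> n3 s2; set s := A n.-1 in s2 *.
have s1 := ltnW s2; have s0 := ltnW s1.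
rewrite -nth0 /canal_axis -/s leqNgt n3 /= nth_trim_head ?size_trim_last //=.
by rewrite /udir !nth_trim_last // (ltn_eqF s1) (ltn_eqF s2).
Qed.

Variables (C : nat -> set (R * R)) (A : nat -> seq (R * R)).
Hypothesis hC : cantor_canals C A.

Local Notation t n := (land_width R n).
Local Notation Q := (@unit_square R).
Local Notation O := (@open_unit_square R).

Let t0 n : 0 < t n. Proof. exact: land_gt0. Qed.

Lemma mint_unit_square : mint Q `<=` O.
Proof.
move=> z [r r0 h].
have [[a _] [b _]] : Q (z.1 - r / 2, z.2 - r / 2) /\ Q (z.1 + r / 2, z.2 + r / 2).
  by split; apply: h; split => /=; lra.
have [c d] : Q (z.1 + r / 2, z.2 + r / 2) by apply: h; split => /=; lra.
have [c' d'] : Q (z.1 - r / 2, z.2 - r / 2) by apply: h; split => /=; lra.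
by move: c d c' d' => /= *; split; lra.
Qed.

Lemma mint_island_open n : mint (island C n) `<=` O.
Proof. by move=> z /(mintS (@island_unit_square _ C n))/mint_unit_square. Qed.

Lemma open_unit_squareS : O `<=` Q.
Proof. by move=> z [h1 h2]; split; lra. Qed.

(* The canal [C m] terminates at [p] in an edge orthogonal to [nu], [nu]
   pointing out of the canal, and no earlier canal touches that edge from outside. *)
Definition tip m p nu : Prop :=
  [/\ unitv nu,
      forall y : R, - (t m / 2) < y < t m / 2 -> C m (pt p nu 0 y) /\ O (pt p nu 0 y)
    & exists2 delta : R, 0 < delta & forall z, - (t m / 2) < across p nu z < t m / 2 ->
      (- delta < along p nu z < 0 -> mint (C m) z) /\
      (0 < along p nu z < delta -> O z /\ forall j, (0 < j <= m)%N -> ~ C j z)].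

(** Behind the edge lies the first open cell of the canal. In front lies the gap of [head_gap],
    which is interior to the island and hence free of earlier canals. [B] stands for the connecting
    band, or for the empty set on Days 2 and 3. *)
Lemma tip_end n s (d : R) (B : set (R * R)) : (0 < n)%N ->
  strip_axis (3 * t n) s -> (2 < size s)%N -> island C n.-1 = strip (3 * t n) s ->
  0 <= d -> C n = tube (t n) s (t n) d `|` B ->
  (forall z, 0 < along s`_0 (udir s 0) z < t n ->
     - (t n / 2) < across s`_0 (udir s 0) z < t n / 2 -> ~ B z) ->
  tip n (pt s`_0 (udir s 0) (t n) 0) (- (udir s 0).1, - (udir s 0).2).
Proof.
move=> n0 axs s2 eI d0 eC hB.
have tn := t0 n; have w0 : 0 <= 3 * t n by lra.
have s1 := ltnW s2; have u1 := udir_unitv w0 axs s1.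
have [l1 _] := seglen_lb tn axs s2 s1.
set u := udir s 0 in u1 hB *; set p := pt _ _ _ _.
have alE z : along p (- u.1, - u.2) z = t n - along s`_0 u z.
  have -> : along p (- u.1, - u.2) z = - along p u z by rewrite /along /=; ring.
  by rewrite along_shift //; ring.
have acE z : across p (- u.1, - u.2) z = - across s`_0 u z.
  have -> : across p (- u.1, - u.2) z = - across p u z by rewrite /across /=; ring.
  by rewrite across_shift //; ring.
have uN := unitvN u1.
split=> // [y hy|].
  set z := pt p _ 0 y.
  have az : along s`_0 u z = t n by have := alE z; rewrite along_pt //; lra.
  have bz : across s`_0 u z = - y by have := acE z; rewrite across_pt //; lra.
  split.
    rewrite eC; left; exists 0%N => //; rewrite /cell /frect /= -/u az bz (ltn_eqF s2).
    by split; lra.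
  apply: (@mint_island_open n.-1); rewrite eI; apply: (strip_int tn axs s1);
    rewrite /= -/u ?az ?bz ?(ltn_eqF s2); lra.
exists (t n / 2); first lra.
move=> z hz; have az := alE z; have bz := acE z; split=> hz'.
  rewrite eC; apply: (@mintS _ (cell (t n) s (t n) d 0)).
    by move=> y hy; left; exists 0%N.
  apply: mintS (@ofrect_sub _ _ _ _ _ _ _) _ _; apply: ofrect_int => //.
  by split; rewrite /= -/u ?(ltn_eqF s2); lra.
have [zI zT] : mint (strip (3 * t n) s) z /\ ~ tube (t n) s (t n) d z.
  by apply: (head_gap tn axs s2 d0); rewrite -/u; lra.
rewrite -eI in zI; split; first exact: mint_island_open zI.
move=> j /andP[j0]; rewrite leq_eqVlt => /orP[/eqP ->|jn].
  by rewrite eC => -[//|]; apply: hB; rewrite -/u; lra.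
apply: mint_island zI; last exact: (canal_mint_dense hC).
by rewrite j0 -ltnS prednK.
Qed.

(** Restricted to the open square because the canals of Days 2 and 3 start on its left side, where
    they are not interior to the island. *)
Definition disjoint_from_other_colours n : Prop :=
  forall m z, (0 < m < n)%N -> (m %% 3 != n %% 3)%N -> O z -> C n z -> ~ C m z.

(** The invariant of a strong induction: the tips of [C (n - 3)] locate the connecting band of
    [C n], and its location yields the three properties of [C n]. *)
Definition canal_ok n : Prop := [/\ C n `<=` island C n.-1,
  disjoint_from_other_colours n & forall p, peak A n p -> exists nu, tip n p nu].

Lemma canal_ok1 : canal_ok 1%N.
Proof.
have eC := canal1E hC; split.
- move=> z; rewrite eC => -[] /=; rewrite /along /across /= => h1 h2.
  by apply: island_outside => [|[]//]; split; lra.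
- by move=> m z; case: m.
move=> p; rewrite /peak /= => ->; exists ((1, 0) : R * R); rewrite /tip land1.
split; first exact: unitv10.
  by move=> y hy; rewrite eC; split; split; rewrite /along /across /pt /=; lra.
exists (1 / 3); first lra.
move=> z; rewrite /along /across /= => hz; split=> hz'.
  rewrite eC; apply: mintS (@ofrect_sub _ _ _ _ _ _ _) _ _; apply: ofrect_int unitv10 _ _.
  by split; rewrite /along /across /=; lra.
split; first by split; lra.
move=> j j1; have -> : j = 1%N by lia.
by rewrite eC => -[]; rewrite /along /across /=; lra.
Qed.

(** The end edge has its midpoint on the left side and the strip stays in the square, so this edge
    is vertical and the strip leaves it to the right. Hence the starting edge of the canal is
    outside the open square. *)
Lemma entrance n : (1 < n <= 3)%N -> ((A n.-1)`_0).1 = 0 /\ udir (A n.-1) 0 = (1, 0).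
Proof.
move=> n23; have n1 : (0 < n.-1)%N by lia.
have s1 : ((A n.-1)`_0).1 = 0.
  case: hC => _ _ [h1 h2] _ _; rewrite nth0.
  have [->|->] : n = 2%N \/ n = 3%N by lia.
    by rewrite /= h1.
  exact: h2.
split=> //; set s := A n.-1 in s1 *.
have axs : strip_axis (t n.-1) s := axis_ok hC n1.
have s2 : (2 < size s)%N := axis_size hC n1.
have tn := t0 n.-1; have w0 := ltW tn.
have ww : 0 <= t n.-1 <= t n.-1 by rewrite w0 lexx.
have h0 := ltnW s2; have u1 := udir_unitv w0 axs h0; have l0 := seglen_gt0 w0 axs h0.
have inQ (x y : R) : 0 <= x <= seglen s 0 -> - (t n.-1 / 2) <= y <= t n.-1 / 2 ->
    Q (pt s`_0 (udir s 0) x y).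
  move=> hx hy; apply: (@island_unit_square _ C n.-1).
  rewrite (islandE hC n1) (strip_tube w0 axs ww); exists 0%N => //.
  by rewrite /cell /frect /= along_pt // across_pt // (ltn_eqF s2); split; lra.
have q1 : Q (pt s`_0 (udir s 0) (seglen s 0) 0) by apply: inQ; lra.
have q2 : Q (pt s`_0 (udir s 0) 0 (t n.-1 / 2)) by apply: inQ; lra.
have q3 : Q (pt s`_0 (udir s 0) 0 (- (t n.-1 / 2))) by apply: inQ; lra.
move: q1 q2 q3 u1; rewrite /unit_square /pt; move: (udir s 0) => u + + + hu.
by move: hu => [->|[->|[->|->]]] //= q1 q2 q3; exfalso; lra.
Qed.

Lemma canal_ok23 n : (1 < n <= 3)%N -> canal_ok n.
Proof.
move=> n23; have n1 : (0 < n.-1)%N by lia.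
have n0 : (1 < n)%N by lia. have n3 : (n <= 3)%N by lia.
have s2 : (2 < size (A n.-1))%N := axis_size hC n1.
have [axs] := canalE hC n0 s2; rewrite n3 => eC.
have tn := t0 n; have w0 : 0 <= 3 * t n by lra.
have eI : island C n.-1 = strip (3 * t n) (A n.-1).
  by rewrite (islandE hC n1) land_prev // ltnW.
have CI : C n `<=` island C n.-1 by rewrite eC eI; apply: tubeS => //; lra.
split=> //.
  move=> m z /andP[m0 mn] _ [z1 z2] Cz; apply: (@mint_island _ C n.-1) => //.
  - by rewrite m0; lia.
  - exact: (canal_mint_dense hC).
  rewrite eI; move: Cz; rewrite eC => -[i hi hz].
  have [e1 e2] := entrance n23.
  apply: (tube_int tn axs hi _ _ hz); [lra|lra| |].
    by move=> i0; subst i; rewrite e2 /along e1 /=; lra.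
  by move=> il; move: hz => []; rewrite il eqxx; lra.
move=> p; rewrite /peak.
have -> : (n == 1)%N = false by lia.
rewrite canal_axis_last // => -[->|[]]; last by rewrite ltnNge n3.
set s := A n.-1 in s2 axs eC eI *.
exists (- (udir (rev s) 0).1, - (udir (rev s) 0).2).
have axr := strip_axis_rev w0 axs.
have s2r : (2 < size (rev s))%N by rewrite size_rev.
apply: (@tip_end n (rev s) 0 set0) => //; first exact: ltnW.
- by rewrite (strip_cells tn axr) (tube_rev w0 axs) eI (strip_cells tn axs).
- by rewrite setU0 (tube_rev w0 axs).
- by move=> z _ _ [].
Qed.

Lemma canal_ok4 n : (3 < n)%N -> (forall m, (0 < m < n)%N -> canal_ok m) -> canal_ok n.
Proof.
move=> n4 IH; have n1 : (0 < n.-1)%N by lia.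
have n0 : (1 < n)%N by lia. have n3 : (n <= 3)%N = false by lia.
have s2 : (2 < size (A n.-1))%N := axis_size hC n1.
have [axs] := canalE hC n0 s2; rewrite n3 => -[p [q [hp hf eC]]].
have tn := t0 n; have w0 : 0 <= 3 * t n by lra.
have eI : island C n.-1 = strip (3 * t n) (A n.-1).
  by rewrite (islandE hC n1) land_prev // ltnW.
have m0 : (0 < n - 3 < n)%N by lia.
have [_ D3 /(_ p hp)[nu [nu1 edge [delta de0 sides]]]] := IH _ m0.
have t3 : t (n - 3) = 27 * t n.
  have e1 := @land_prev R n.-1; have e2 := @land_prev R n; have e3 := @land_prev R n.-2.
  rewrite (_ : (n - 3)%N = n.-1.-1.-1); last by clear -n4; lia.
  by rewrite e3 ?e1 ?e2; [lra|clear -n4; lia..].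
set h := t (n - 3) / 2 in edge sides.
(* The canals of the two days in between have other colours than [C (n - 3)], so by induction they
   miss its edge at [p]. *)
have off j y : (n - 3 < j < n)%N -> - h < y < h -> ~ C j (pt p nu 0 y).
  move=> hj hy Cj; have [Ce Oe] := edge y hy.
  have jn : (0 < j < n)%N by clear -hj; lia.
  have [_ D _] := IH j jn.
  by apply: (D (n - 3)%N _ _ _ Oe Cj Ce); clear -n4 hj; lia.
(* In front of the edge, canals up to Day [n - 3] are absent because [p] is a tip, and the two later
   ones because they are closed and miss the edge point. The radius also keeps [z] opposite the
   edge. *)
have ahead (y : R) : - h < y < h -> exists2 rho : R, 0 < rho &
    forall z, nbd (pt p nu 0 y) rho z -> 0 < along p nu z -> strip (3 * t n) (A n.-1) z.
  move=> hy.
  have [r1 r10 h1] : exists2 r, 0 < r & forall z, nbd (pt p nu 0 y) r z -> ~ C n.-1 z.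
    by apply: (canal_co_open hC n1); apply: off => //; clear -n4; lia.
  have [r2 r20 h2] : exists2 r, 0 < r & forall z, nbd (pt p nu 0 y) r z -> ~ C n.-2 z.
    by apply: (canal_co_open hC); [|apply: off => //]; clear -n4; lia.
  have hy0 : 0 < Num.min (y + h) (h - y) by rewrite lt_min; apply/andP; split; lra.
  have [r3 [r30 r31 r32 r33]] := exists_lt3 r10 r20 de0.
  have [r [r0 r3' ry _]] := exists_lt3 r30 hy0 hy0.
  exists r => // z zr az.
  have [a1 a2] := (nbdE p nu1).1 zr; rewrite along_pt // across_pt // in a1 a2.
  have [k1 k2] : r < y + h /\ r < h - y.
    by move: ry; rewrite lt_min => /andP[]; split.
  have [_ /(_ ltac:(lra))[Oz nC]] := sides z ltac:(lra).
  rewrite -eI; apply: island_outside; first exact: open_unit_squareS.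
  move=> m hm; have [|[->|->]] : (0 < m <= n - 3)%N \/ m = n.-2 \/ m = n.-1 by clear -n4 hm; lia.
  - exact: nC.
  - by apply: h2; apply: nbdS zr; lra.
  - by apply: h1; apply: nbdS zr; lra.
have behind z : - delta < along p nu z < 0 -> - h < across p nu z < h ->
    ~ strip (3 * t n) (A n.-1) z.
  move=> k1 k2; rewrite -eI => zI.
  have [/(_ k1) Cz _] := sides z k2.
  by apply: (@island_mint _ C n.-1 (n - 3) z _ zI Cz); clear -n4; lia.
(* Three days divide the width by 27, so the earlier edge is much wider than the present strip. *)
have h3 : 3 * t n < h by rewrite /h t3; lra.
have [i [x [eta gf]]] := good_footP tn axs s2 nu1 h3 de0 ahead behind hf.
have CI : C n `<=` island C n.-1.
  rewrite eC eI => z [|]; first by apply: tubeS => //; lra.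
  exact: (foot_band_strip tn axs gf).
have h0 : - h < 0 < h by lra.
have p0 : pt p nu 0 0 = p by case: (p) => a b; rewrite /pt /=; congr (_, _); lra.
have [Cp _] := edge 0 h0; rewrite p0 in Cp.
have pS : ~ mint (strip (3 * t n) (A n.-1)) p.
  rewrite -eI => pI; apply: (mint_island _ _ pI Cp); first by clear -n4; lia.
  by apply: (canal_mint_dense hC); clear -n4; lia.
split=> //.
  (* In the open square, [C n] is interior to the island except for the edge of its band at [p].
     That edge is part of the edge of [C (n - 3)], which has the same colour as [C n]. *)
  move=> m z /andP[m1 mn] mod3 Oz Cz.
  have zint : mint (strip (3 * t n) (A n.-1)) z -> ~ C m z.
    rewrite -eI => zI; apply: mint_island zI; first by rewrite m1; clear -mn; lia.
    exact: (canal_mint_dense hC).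
  move: Cz; rewrite eC => -[[j hj hz]|].
    apply: zint; apply: (tube_int tn axs hj _ _ hz); [lra|lra| |].
      by move=> j0; subst j; case: hz => /= ? _; lra.
    by move=> jl; move: hz => []; rewrite jl eqxx; lra.
  move=> /(foot_band_int tn axs gf)[//|[a1 a2]].
  have ez : z = pt p nu 0 (across p nu z) by rewrite -a1 pt_along.
  have hz : - h < across p nu z < h by rewrite /h t3; lra.
  have [Cz _] := edge _ hz; rewrite -ez in Cz.
  have [mlt|mge] := ltnP m (n - 3)%N.
    by apply: (D3 m z _ _ Oz Cz); clear -m1 mlt n4 mod3; lia.
  rewrite ez; apply: off => //; rewrite mn andbT ltn_neqAle mge andbT.
  by apply/eqP => e; move: mod3; rewrite -e; clear -n4; lia.
move=> p'; rewrite /peak.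
have -> : (n == 1)%N = false by clear -n4; lia.
rewrite canal_axis_last // canal_axis_head //.
set s := A n.-1 in s2 axs eC eI gf pS *.
have [hi _ _ _ _] : foot_at (t n) s i x eta p q by case: gf.
case=> [->|[_ ->]].
  exists (- (udir (rev s) 0).1, - (udir (rev s) 0).2).
  have axr := strip_axis_rev w0 axs.
  have s2r : (2 < size (rev s))%N by rewrite size_rev.
  have sr : strip (3 * t n) (rev s) = strip (3 * t n) s.
    by rewrite (strip_cells tn axr) (tube_rev w0 axs) (strip_cells tn axs).
  have ij : (i + (size s - i.+2)).+2 = size s by clear -hi; lia.
  have gr := good_foot_rev tn axs s2 ij gf.
  apply: (@tip_end n (rev s) (t n) (band (t n) p q)) => //; [exact: ltnW|by rewrite sr|lra| |].
    by rewrite (tube_rev w0 axs).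
  move=> z z1 z2; apply: (foot_band_gap tn axr s2r gr) => //; first by rewrite sr.
exists (- (udir s 0).1, - (udir s 0).2).
apply: (@tip_end n s (t n) (band (t n) p q)) => //; [exact: ltnW|lra|].
by move=> z z1 z2; apply: (foot_band_gap tn axs s2 gf).
Qed.

Lemma canals_ok n : (0 < n)%N -> canal_ok n.
Proof.
elim/ltn_ind: n => n IH n0.
have [->|n1] := eqVneq n 1%N; first exact: canal_ok1.
have [n3|n3] := leqP n 3%N; first by apply: canal_ok23; lia.
by apply: canal_ok4 => // m /andP[m0 mn]; exact: IH.
Qed.

End Tips.
(** * The common shore *)

Section Lakes.
Context {R : realType}.
Implicit Types (z y p q nu : R * R) (n m i j k c : nat) (S : set (R * R)).

(** Take the supremum of the parameters whose points are in [S]: such parameters approach it, and if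
    its point were interior to [S], larger ones would exist. *)
Lemma frontier_on_segment S y1 y2 : S y1 -> ~ S y2 -> exists2 lam : R, 0 <= lam <= 1 &
  let w := (y1.1 + lam * (y2.1 - y1.1), y1.2 + lam * (y2.2 - y1.2)) in
  closure S w /\ ~ mint S w.
Proof.
move=> S1 S2.
pose g (x : R) : R * R := (y1.1 + x * (y2.1 - y1.1), y1.2 + x * (y2.2 - y1.2)).
have g0 : g 0 = y1 by rewrite /g; case: (y1) => a b /=; congr (_, _); lra.
have g1 : g 1 = y2 by rewrite /g; case: (y2) => a b /=; congr (_, _); lra.
pose T : set R := [set x | 0 <= x <= 1 /\ S (g x)].
have T0 : T 0 by split; [lra|rewrite g0].
have hT : has_sup T by split; [exists 0|exists 1 => x [] /andP[]].
have l0 : 0 <= sup T by apply: ub_le_sup => //; exact: hT.2.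
have l1 : sup T <= 1 by apply: ge_sup; [exists 0|move=> x [] /andP[]].
pose M := 1 + `|y2.1 - y1.1| + `|y2.2 - y1.2|.
have M0 : 0 < M by rewrite /M; have := normr_ge0 (y2.1 - y1.1);
  have := normr_ge0 (y2.2 - y1.2); lra.
have lip x x' r : `|x' - x| < r / M -> nbd (g x) r (g x').
  rewrite ltr_pdivlMr // => h.
  have d1 : `|(x' - x) * (y2.1 - y1.1)| < r.
    rewrite normrM; apply: le_lt_trans h; apply: ler_wpM2l => //.
    by rewrite /M; have := normr_ge0 (y2.2 - y1.2); lra.
  have d2 : `|(x' - x) * (y2.2 - y1.2)| < r.
    rewrite normrM; apply: le_lt_trans h; apply: ler_wpM2l => //.
    by rewrite /M; have := normr_ge0 (y2.1 - y1.1); lra.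
  by move: d1 d2; rewrite !ltr_norml /g => d1 d2; split => /=; lra.
exists (sup T); first by rewrite l0.
rewrite /= -/(g (sup T)); split.
  apply/closureP => r r0; have rM : 0 < r / M by rewrite divr_gt0.
  have [x Tx hx] := sup_adherent rM hT.
  exists (g x); last by case: Tx.
  apply: lip; have : x <= sup T by apply: ub_le_sup => //; exact: hT.2.
  by move=> h; rewrite ler0_norm; lra.
move=> [r r0 hr].
have [e|ne] := eqVneq (sup T) 1.
  by apply: S2; apply: hr; rewrite e g1; exact: nbd_id.
have l1' : sup T < 1 by rewrite lt_neqAle ne.
have rM : 0 < r / M by rewrite divr_gt0.
have l1s : 0 < 1 - sup T by lra.
have [d [d0 d1 d2 _]] := exists_lt3 rM l1s l1s.
have : T (sup T + d).
  split; first lra.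
  by apply: hr; apply: lip; rewrite addrC addKr gtr0_norm.
by move=> /(ub_le_sup hT.2); lra.
Qed.

Variables (C : nat -> set (R * R)) (A : nat -> seq (R * R)).
Hypothesis hC : cantor_canals C A.

Local Notation t n := (land_width R n).
Local Notation Q := (@unit_square R).
Local Notation O := (@open_unit_square R).

Let t0 n : 0 < t n. Proof. exact: land_gt0. Qed.

Lemma canals_disjoint m n z : (0 < m)%N -> (0 < n)%N -> (m %% 3 != n %% 3)%N ->
  O z -> C m z -> C n z -> False.
Proof.
move=> m0 n0 mn Oz Cm Cn; have [mltn|nltm|e] := ltngtP m n.
- have [_ D _] := canals_ok hC n0; apply: (D m z) => //; by rewrite m0.
- have [_ D _] := canals_ok hC m0; apply: (D n z) => //; by [rewrite n0|rewrite eq_sym].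
- by move: mn; rewrite e eqxx.
Qed.

Lemma canalS n : (0 < n)%N -> C n `<=` Q.
Proof. by move=> n0 z; have [CI _ _] := canals_ok hC n0 => /CI; exact: island_unit_square. Qed.

(** The distance is less than [2 * t n.+1] to the canal, plus [t n.+1] to its interior. The canals
    of Days 2 and 3 contain the tube trimmed at both ends. *)
Lemma near_canal n z : (0 < n)%N -> island C n z ->
  exists2 y, nbd z (t n) y & mint (C n.+1) y.
Proof.
move=> n0; rewrite (islandE hC n0) (landS n) => hz.
have s2 := axis_size hC n0; have tn := t0 n.+1.
have [axs hn] := canalE hC (n := n.+1) n0 s2.
have [y zy ty] := tube_near tn axs s2 hz.
have Cy : C n.+1 y.
  move: hn; case: ifP => _ => [->|[p [q [_ _ ->]]]]; last by left.
  move: ty => [i hi [h1 h2]]; exists i => //; split; last exact: h2.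
  by move: h1; case: (i == 0)%N; lra.
have [y' [a1 a2] Cy'] := canal_mint_dense hC (n := n.+1) isT Cy tn.
by exists y' => //; case: zy => b1 b2; split; lra.
Qed.

(** The canal spares one of the two wall points of [strip_walls], since points of the connecting
    band are less than [2 * t n.+1] apart. *)
Lemma near_next_island n z : (0 < n)%N -> island C n z ->
  exists2 y, nbd z (2 * t n) y & island C n.+1 y.
Proof.
move=> n0 zI; have s2 := axis_size hC n0; have tn := t0 n.+1.
have [axs hn] := canalE hC (n := n.+1) n0 s2.
have eI : island C n = strip (3 * t n.+1) (A n) by rewrite (islandE hC n0) (landS n).
have := zI; rewrite eI => /(strip_walls tn axs s2).
move=> [y1 [y2 [a [u [[u1 I1 I2 T1 T2] [z1 z2 [e1 e2]]]]]]].
have next y : nbd z (6 * t n.+1) y -> mint (strip (3 * t n.+1) (A n)) y -> ~ C n.+1 y ->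
    exists2 y, nbd z (2 * t n) y & island C n.+1 y.
  rewrite -eI => zy Iy nC; exists y; first by rewrite (landS n); apply: nbdS zy; lra.
  apply: island_outside; first by apply: (@island_unit_square _ C n); exact: mint_sub.
  move=> m /andP[m0]; rewrite leq_eqVlt => /orP[/eqP ->//|mn].
  by apply: mint_island Iy; [rewrite m0|exact: (canal_mint_dense hC)].
have notT d y : 0 <= d -> ~ tube (t n.+1) (A n) 0 0 y -> ~ tube (t n.+1) (A n) d (t n.+1) y.
  move=> d0 nT [i hi [h1 h2]]; apply: nT; exists i => //; split; last exact: h2.
  by move: h1; case: (i == 0)%N; case: (_ == size _); lra.
move: hn; case: ifP => _ => [eC|[p [q [_ hf eC]]]].
  by apply: (next y1) => //; rewrite eC; apply: notT.
have [i [x [eta ha]]] := footP tn axs hf.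
have [b1|nb1] := pselect (band (t n.+1) p q y1); last first.
  by apply: (next y1) => //; rewrite eC => -[|//]; apply: notT => //; exact: ltW.
apply: (next y2) => //; rewrite eC => -[|b2].
  by apply: notT => //; exact: ltW.
move: b1 b2; rewrite (foot_frect tn axs ha) => -[k1 k2] [k3 k4].
have [hi hx heta _ _] := ha.
have w0 : 0 <= 3 * t n.+1 by lra.
have ui := udir_unitv w0 axs hi.
have : nbd y1 (2 * t n.+1) y2.
  apply/(nbdE (A n)`_i ui); split; first lra.
  by move: k2 k4; case: ifP => _; lra.
by move=> /(nbdE a u1)[_]; lra.
Qed.

Lemma lakeP c z : lake C c z <->
  exists k, mint (\bigcup_(j in [set j | (j <= k)%N]) C (3 * j + c)%N) z.
Proof.
split=> [[k _]|[k h]]; rewrite /lake_stage ?interior_mint => *; first by exists k.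
by exists k => //; rewrite /lake_stage interior_mint.
Qed.

Lemma mint_lake c : mint (lake C c) = lake C c.
Proof.
apply/seteqP; split; first exact: mint_sub.
move=> z /lakeP[k /mint_open[r r0 h]]; exists r => // y /h hy.
by apply/lakeP; exists k.
Qed.

Lemma canal_lake j c : mint (C (3 * j + c)%N) `<=` lake C c.
Proof. by move=> z hz; apply/lakeP; exists j; apply: mintS hz => y Cy; exists j => /=. Qed.

Lemma lake_canal c z : (0 < c)%N -> lake C c z -> exists n, [/\ (0 < n)%N,
  (n %% 3 = c %% 3)%N & C n z].
Proof.
move=> c0 /lakeP[k /mint_sub[j _ Cz]]; exists (3 * j + c)%N; split => //.
  by rewrite addn_gt0 c0 orbT.
by rewrite mulnC modnMDl.
Qed.

Lemma lakeS c : (0 < c)%N -> lake C c `<=` O.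
Proof.
move=> c0; rewrite -mint_lake => z hz; apply: mint_unit_square; apply: mintS hz => y.
by move=> /(lake_canal c0)[n [n0 _]]; exact: canalS.
Qed.

Lemma lakes_disjoint c c' z : (0 < c)%N -> (0 < c')%N -> (c %% 3 != c' %% 3)%N ->
  lake C c z -> lake C c' z -> False.
Proof.
move=> c0 c0' cc hz hz'; have Oz := lakeS c0 hz.
have [n [n0 e Cn]] := lake_canal c0 hz; have [m [m0 e' Cm]] := lake_canal c0' hz'.
by apply: (@canals_disjoint n m z) => //; rewrite e e'.
Qed.

Lemma colour n : (0 < n)%N -> exists j c, (0 < c <= 3)%N /\ n = (3 * j + c)%N.
Proof.
move=> n0; exists (n.-1 %/ 3)%N, (n.-1 %% 3).+1; split; first by rewrite ltn_mod.
by rewrite addnS mulnC -divn_eq prednK.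
Qed.

(** A neighbourhood of [z] is covered by finitely many canals. Those of other colours than the one
    through [z] form a closed set that misses [z], so a smaller neighbourhood has a single
    colour. *)
Lemma off_island n z : O z -> ~ island C n z -> exists c r, [/\ (0 < c <= 3)%N, 0 < r,
  nbd z r `<=` lake C c & lake C c z].
Proof.
move=> Oz nI.
have [r r0 hr] : exists2 r, 0 < r &
    forall y, nbd z r y -> Q y -> exists2 m, (0 < m <= n)%N & C m y.
  apply: contrapT => h; apply: nI; apply/islandP => r r0.
  apply: contrapT => k; apply: h; exists r => // y zy Qy.
  apply: contrapT => k'; apply: k; exists y; split => // m mn Cy.
  by apply: k'; exists m.
have [m0 /andP[m00 m0n] Cz] := hr z (nbd_id _ r0) (open_unit_squareS Oz).
have [j0 [c [c3 em0]]] := colour m00.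
have em : (m0 %% 3 = c %% 3)%N by rewrite em0 mulnC modnMDl.
have [r1 r10 h1] : exists2 r, 0 < r & forall y, nbd z r y ->
    ~ (\bigcup_(m in [set m | (0 < m <= n)%N /\ (m %% 3 != c %% 3)%N]) C m) y.
  apply: (@co_open_bigcup _ _ _ n) => [m [/andP[]]|m [/andP[m1 _] _]|] //.
    exact: (canal_co_open hC).
  move=> [m [/andP[m1 mn] mc] Cm]; apply: (@canals_disjoint m m0 z) => //.
  by rewrite em.
have [r2 r20 h2] : mint Q z.
  have [/andP[a1 a2] /andP[b1 b2]] := Oz.
  have : ofrect (0, 0) (1, 0) 0 1 0 1 z by split; rewrite /along /across /=; lra.
  by move=> /(ofrect_int unitv10); rewrite unit_squareE; apply: mintS; exact: ofrect_sub.
have [r3 [r30 r31 r32 r33]] := exists_lt3 r0 r10 r20.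
have sub : nbd z r3 `<=` \bigcup_(j in [set j | (j <= n)%N]) C (3 * j + c)%N.
  move=> y zy.
  have [m mn Cy] := hr y (nbdS (ltW r31) zy) (h2 _ (nbdS (ltW r33) zy)).
  have mc : (m %% 3 = c %% 3)%N.
    apply: contrapT => /eqP mc; apply: (h1 y (nbdS (ltW r32) zy)).
    by exists m.
  (* For [c = 3] the quotient of [m] by 3 exceeds the index by one. *)
  exists (m %/ 3 - (c == 3))%N; first by rewrite /=; clear -mn; lia.
  by rewrite (_ : (3 * (m %/ 3 - (c == 3)) + c)%N = m) //; clear -mc c3 mn; lia.
have lz : nbd z (r3 / 2) `<=` lake C c.
  move=> y [y1 y2]; apply/lakeP; exists n; exists (r3 / 2); first lra.
  by move=> x [x1 x2]; apply: sub; split; lra.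
exists c, (r3 / 2); split => //; first lra.
by apply: lz; apply: nbd_id; lra.
Qed.

Lemma land_small (e : R) : 0 < e -> exists N, forall n, (N <= n)%N -> t n < e.
Proof.
move=> e0; exists (Num.bound e^-1) => n Nn.
have e1 : e^-1 < n%:R.
  apply: lt_le_trans (archi_boundP _) _; first by rewrite invr_ge0 ltW.
  by rewrite ler_nat.
have n3 : n%:R < 3 ^+ n :> R by rewrite -natrX ltr_nat ltn_expl.
rewrite /land_width -[e]invrK ltf_pV2 ?posrE ?exprn_gt0 ?invr_gt0 //.
exact: lt_trans n3.
Qed.

(** The right-hand side does not depend on [c]. A point off some island has a neighbourhood in one
    lake, hence is on no shore; a point of all islands has canals of each colour arbitrarily close
    and is in the interior of no finite union of canals. *)
Lemma shoreE c : (0 < c <= 3)%N ->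
  shore C c = O `&` [set z | forall n, island C n z].
Proof.
move=> c3; have c0 : (0 < c)%N by case/andP: c3.
apply/seteqP; split => z [Oz].
  rewrite /frontier interior_mint mint_lake => -[/closureP clz nz]; split => // n.
  apply: contrapT => nI; have [c' [r [c3' r0 sub lz]]] := off_island Oz nI.
  have c0' : (0 < c')%N by case/andP: c3'.
  have [e|ne] := eqVneq c c'; first by apply: nz; rewrite e.
  have [y /sub ly ly'] := clz _ r0.
  by apply: (@lakes_disjoint c c' y) => //; lia.
move=> zI; split => //; rewrite /frontier interior_mint mint_lake; split.
  apply/closureP => r r0; have [N hN] := land_small r0.
  (* The canal dug on the day after this one is [C (3 * N.+1 + c)], of the required colour and close
     enough to [z]. *)
  have n1 : (0 < 3 * N.+1 + c.-1)%N by lia.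
  have [y zy Cy] := near_canal n1 (zI _).
  exists y; first by apply: nbdS zy; apply/ltW/hN; lia.
  by apply: (@canal_lake N.+1); move: Cy; rewrite -addnS prednK.
move=> /lakeP[k [r r0 h]]; have := zI (3 * k + c)%N.
move=> /islandP/(_ _ r0)[y [/h [j /= jk Cy] _ nC]].
by apply: (nC _ _ Cy); lia.
Qed.

(** Canals of consecutive days belong to different lakes, so a segment from one to the other crosses
    a shore, no farther from [z] than its ends by convexity. The farther end is within
    [2 * t n + t n.+1]. *)
Lemma near_shore n z : (0 < n)%N -> island C n z ->
  exists2 y, nbd z (3 * t n) y & shore C 1 y.
Proof.
move=> n0 zI; have tn := t0 n; have tn1 := @landS R n; have tn' := t0 n.+1.
have [y1 [a1 a2] C1] := near_canal n0 zI.
have [x [b1 b2] xI] := near_next_island n0 zI.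
have [y2 [d1 d2] C2] := near_canal (n := n.+1) isT xI.
have [j1 [c1 [c13 e1]]] := colour (n := n.+1) isT.
have [j2 [c2 [c23 e2]]] := colour (n := n.+2) isT.
rewrite e1 in C1; rewrite e2 in C2.
have L1 := canal_lake C1; have L2 := canal_lake C2.
have c10 : (0 < c1)%N by case/andP: c13.
have c20 : (0 < c2)%N by case/andP: c23.
have cc : (c1 %% 3 != c2 %% 3)%N by clear -e1 e2; lia.
have nL : ~ lake C c1 y2 by move=> h; apply: (lakes_disjoint c10 c20 cc h L2).
have [lam hl /= [clw iw]] := frontier_on_segment L1 nL.
set w := (_, _) in clw iw.
have O1 := lakeS c10 L1; have O2 := lakeS c20 L2.
have conv (u v lo up : R) : lo < u < up -> lo < v < up -> lo < u + lam * (v - u) < up.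
  move=> hu hv; case/andP: hl => l0 l1.
  have [uv|/ltW uv] := lerP u v.
    have h1 : 0 <= lam * (v - u) by rewrite mulr_ge0 // subr_ge0.
    have h2 : lam * (v - u) <= v - u by rewrite ler_piMl // subr_ge0.
    lra.
  have h1 : 0 <= lam * (u - v) by rewrite mulr_ge0 // subr_ge0.
  have h2 : lam * (u - v) <= u - v by rewrite ler_piMl // subr_ge0.
  lra.
exists w; last first.
  have -> : shore C 1 = shore C c1 by rewrite !shoreE.
  split; last by rewrite /frontier interior_mint.
  by case: O1 O2 => p1 p2 [q1 q2]; split; apply: conv.
have p1 : z.1 - 3 * t n < y1.1 < z.1 + 3 * t n by lra.
have p2 : z.2 - 3 * t n < y1.2 < z.2 + 3 * t n by lra.
have q1 : z.1 - 3 * t n < y2.1 < z.1 + 3 * t n by lra.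
have q2 : z.2 - 3 * t n < y2.2 < z.2 + 3 * t n by lra.
have := conv _ _ _ _ p1 q1; have := conv _ _ _ _ p2 q2.
by rewrite /w => k1 k2; split => /=; lra.
Qed.

End Lakes.
(** * Box dimension *)

Section BoxDimension.
Context {R : realType}.
Implicit Types (S : set (R * R)) (e w : R) (k m n i : nat).

Lemma coverable_sub S S' e e' k : S `<=` S' -> e <= e' -> coverable S' e k -> coverable S e' k.
Proof.
move=> SS ee [c hc]; exists c => z /SS /hc[i _ [h1 h2]]; exists i => //.
by split; lra.
Qed.

Lemma coverableU S S' e k m : coverable S e k -> coverable S' e m ->
  coverable (S `|` S') e (k + m).
Proof.
move=> [c hc] [c' hc'].
exists (fun i : 'I_(k + m) => match fintype.split i with inl j => c j | inr j => c' j end).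
move=> z [/hc|/hc'] [j _ hj].
  by exists (lshift m j) => //; rewrite /= -[lshift m j]/(unsplit (inl j)) unsplitK.
by exists (rshift k j) => //; rewrite /= -[rshift k j]/(unsplit (inr j)) unsplitK.
Qed.

Lemma coverable_bigcup n (F : nat -> set (R * R)) (kk : nat -> nat) e :
  (forall i, (i < n)%N -> coverable (F i) e (kk i)) ->
  coverable (\bigcup_(i in [set i | (i < n)%N]) F i) e (\sum_(i < n) kk i).
Proof.
elim: n => [|n IH] h.
  by rewrite big_ord0; exists (fun _ => 0) => z [].
rewrite big_ord_recr /=.
have h1 := IH (fun i hi => h i (ltnW hi)).
apply: coverable_sub (lexx e) (coverableU h1 (h n (ltnSn n))) => z [i /=].
by rewrite ltnS leq_eqVlt => /orP[/eqP ->|hi Fz]; [right|left; exists i].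
Qed.

Lemma frect_coverable (a u : R * R) (x1 x2 : R) w k : unitv u -> 0 < w ->
  x2 - x1 < k%:R * w -> coverable (frect a u x1 x2 (- (w / 2)) (w / 2)) w k.
Proof.
move=> hu w0 hk.
exists (fun j : 'I_k => ((pt a u (x1 + (j%:R + 1 / 2) * w) 0).1 - w / 2,
                         (pt a u (x1 + (j%:R + 1 / 2) * w) 0).2 - w / 2)).
move=> z [h1 h2].
have y0 : 0 <= (along a u z - x1) / w by rewrite divr_ge0 ?(ltW w0) //; lra.
have /andP[t1 t2] := truncn_itv y0.
set j := Num.truncn _ in t1 t2.
move: t1 t2; rewrite ler_pdivlMr // ltr_pdivrMr // => t1 t2.
have jk : (j < k)%N.
  by rewrite -(ltr_nat R) -(ltr_pM2r w0); lra.
move: t2; rewrite -natr1 => t2.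
exists (Ordinal jk) => //=.
move: t1 t2 h1 h2; rewrite mulrDl !mulrDl; set jw := j%:R * w.
by rewrite /box /along /across /pt; move: hu => [->|[->|[->|->]]] /= t1 t2 h1 h2; split; lra.
Qed.

(** With [l] the length of a segment, its cell has length at most [l + w] and its boxes have total
    length at most [l + 2 * w]; since [w / 2 <= l], this is at most [5 * l]. *)
Lemma strip_coverable w s : 0 < w -> strip_axis w s -> (2 < size s)%N ->
  exists2 k, coverable (strip w s) w k & k%:R * w <= 5 * axis_length s.
Proof.
move=> w0 axs s2; have w0' := ltW w0.
have ww : 0 <= w <= w by rewrite w0' lexx.
pose kk i := (Num.truncn (seglen s i / w)).+2.
have lb i : (i.+1 < size s)%N -> w / 2 <= seglen s i.
  move=> hi; have := seglen_gt axs hi; have [-> ->] := corner_ends hi.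
  have := two_ends i s2.
  by case: (i == 0)%N; case: (_ == size s) => //= _; lra.
have kkE i : (i.+1 < size s)%N -> seglen s i + w < (kk i)%:R * w <= seglen s i + 2 * w.
  move=> hi; have l0 := lb i hi.
  have y0 : 0 <= seglen s i / w by rewrite divr_ge0 //; lra.
  have := truncn_itv y0; rewrite ler_pdivlMr // ltr_pdivrMr // /kk.
  by rewrite -!natr1 !mulrDl; lra.
exists (\sum_(i < (size s).-1) kk i)%N.
  rewrite (strip_tube w0' axs ww).
  apply: (@coverable_sub _ (\bigcup_(i in [set i | (i < (size s).-1)%N]) cell w s 0 0 i) w w).
  - by move=> z [i hi hz]; exists i => //=; rewrite ltn_predRL.
  - exact: lexx.
  apply: coverable_bigcup => i; rewrite ltn_predRL => hi.
  apply: frect_coverable => //; first exact: (udir_unitv w0' axs).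
  by have := kkE i hi; case: (i == 0)%N; case: (_ == size s); lra.
rewrite natr_sum mulr_suml /axis_length mulr_sumr.
apply: ler_sum => i _.
have hi : (i.+1 < size s)%N by rewrite -ltn_predRL.
by have := kkE i hi; have := lb i hi; lra.
Qed.

Lemma covering_numberP S e k : coverable S e k ->
  coverable S e (covering_number S e) /\ (covering_number S e <= k)%N.
Proof.
move=> ck.
have ex : exists m, `[< coverable S e m >] by exists k; apply/asboolP.
have ex' : exists m, [set k | coverable S e k /\
    forall m, coverable S e m -> (k <= m)%N] m.
  case: (ex_minnP ex) => m /asboolP cm mm; exists m; split => // j cj; apply: mm; exact/asboolP.
by have [cm mm] := xgetPex 0%N ex'; split; [exact: cm|exact: mm].
Qed.

Lemma boxE (c : R * R) e : box c e = frect c (1, 0) 0 e 0 e.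
Proof.
by apply/seteqP; split => z; rewrite /box /frect /along /across /= => -[h1 h2]; split; lra.
Qed.

Lemma coverable_area S e k : 0 <= e -> mble S -> coverable S e k ->
  (area S <= (k%:R * e ^+ 2)%:E)%E.
Proof.
move=> e0 mS [c hc].
have hb (i : 'I_k) : mble (box (c i) e) /\ area (box (c i) e) = (e ^+ 2)%:E.
  by rewrite boxE; have [||m ->] := @frect_area R (c i) (1, 0) 0 e 0 e unitv10; rewrite ?subr0.
have mb (i : 'I_k) : mble (box (c i) e) by have [] := hb i.
apply: le_trans (area_le mS (mble_bigU mb) _) _.
  by move=> z /hc[i _ hz]; rewrite -bigcup_seq; exists i => //=; rewrite mem_index_enum.
apply: le_trans (area_bigU_le mb) _.
rewrite (eq_bigr (fun _ => (e ^+ 2)%:E)) => [|i _]; last by have [] := hb i.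
by rewrite sumEFin lee_fin sumr_const card_ord mulr_natl.
Qed.

Lemma limf_esup_at_right (f : R -> \bar R) (d : R) :
  (forall eta, 0 < eta -> exists2 delta, 0 < delta & forall e, 0 < e < delta ->
     ((d - eta)%:E <= f e <= (d + eta)%:E)%E) ->
  limf_esup f 0^'+ = d%:E.
Proof.
move=> h.
have near (delta : R) : 0 < delta -> 0^'+ [set e | 0 < e < delta].
  move=> d0; apply: filterS2 (nbhs_right_gt 0) (nbhs_right_lt d0) => e /= -> ->.
  by [].
apply/eqP; rewrite limf_esupE eq_le; apply/andP; split.
  apply/lee_addgt0Pr => eta eta0; have [delta d0 hd] := h _ eta0.
  apply: ereal_inf_le; exists (ereal_sup (f @` [set e | 0 < e < delta])).
    by exists [set e | 0 < e < delta] => //; exact: near.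
  by apply: ge_ereal_sup => _ [e /= /hd/andP[_ he] <-]; rewrite -EFinD.
apply: le_ereal_inf_tmp => _ [V hV <-].
apply/lee_addgt0Pr => eta eta0; have [delta d0 hd] := h _ eta0.
have [e [Ve /hd/andP[he _]]] := filter_ex (filterI hV (near _ d0)).
have : ((d - eta)%:E <= ereal_sup (f @` V))%E.
  by apply: le_trans he _; apply: ereal_sup_ubound; exists e.
by rewrite EFinB leeBlDr.
Qed.

Lemma box_dim_limit S (d : R) :
  (forall eta, 0 < eta -> exists2 delta, 0 < delta & forall e, 0 < e < delta ->
     `|ln (covering_number S e)%:R / ln (1 / e) - d| <= eta) ->
  has_box_dim S d.
Proof.
move=> h; split.
  apply: limf_esup_at_right => eta /h[delta d0 hd]; exists delta => // e /hd.
  by rewrite ler_norml /box_ratio !lee_fin => ?; apply/andP; split; lra.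
rewrite /lower_box_dim /limf_einf (@limf_esup_at_right _ (- d)) ?EFinN ?oppeK //.
move=> eta /h[delta d0 hd]; exists delta => // e /hd.
by rewrite ler_norml /box_ratio -EFinN !lee_fin => ?; apply/andP; split; lra.
Qed.

(* The error in the logarithmic ratio is [O (1 / ln (1 / e))]. *)
Lemma box_dim_of_bounds S (c : R) : 1 <= c ->
  (forall n e, (0 < n)%N -> 3 ^- n <= e < 3 * 3 ^- n ->
    6 ^+ n / c <= (covering_number S e)%:R <= c * 6 ^+ n) ->
  has_box_dim S (ln 6 / ln 3).
Proof.
move=> c1 hN; have c0 : 0 < c by lra.
have l3 : 0 < ln 3 :> R by apply: ln_gt0; lra.
have l6 : 0 < ln 6 :> R by apply: ln_gt0; lra.
have lc : 0 <= ln c by apply: ln_ge0.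
set d := ln 6 / ln 3.
have dl : d * ln 3 = ln 6 by rewrite /d divfK // gt_eqF.
have d0 : 0 < d by rewrite divr_gt0.
apply: box_dim_limit => eta eta0.
(* [ln N] differs from [n] times [ln 6] by at most [ln c], and [d * ln (1 / e)] by at most
   [d * ln 3 = ln 6]. *)
pose M := ln c + ln 6.
(* The bound 1 / 2 excludes [n = 0]; the other one makes [M / ln (1 / e)] smaller than [eta]. *)
exists (Num.min (1 / 2) (expR (- (M / eta)))).
  by rewrite lt_min expR_gt0 andbT; lra.
move=> e /andP[e0]; rewrite lt_min => /andP[e1 e2].
have [n n0 /andP[ne1 ne2]] : exists2 n, (0 < n)%N & 3 ^- n <= e < 3 * 3 ^- n.
  have ex : exists n, 3 ^- n <= e.
    by have [N hN'] := @land_small R e e0; exists N; apply/ltW/hN'.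
  case: (ex_minnP ex) => -[|n] h1 h2; first by move: h1; rewrite expr0 invr1; lra.
  exists n.+1 => //; rewrite h1 /= ltNge; apply/negP => h3.
  have : (n.+1 <= n)%N by apply: h2; have := @landS R n; rewrite /land_width => ->.
  by rewrite ltnn.
have /andP[N1 N2] := hN n e n0 ltac:(by rewrite ne1).
set N := (covering_number S e)%:R in N1 N2 *.
have p6 : 0 < 6 ^+ n :> R by rewrite exprn_gt0.
have p3 : 0 < 3 ^+ n :> R by rewrite exprn_gt0.
have Npos : 0 < N by apply: lt_le_trans N1; rewrite divr_gt0.
have lN1 : ln 6 *+ n - ln c <= ln N.
  by rewrite -lnXn ?ltr0n // -ln_div ?posrE // ler_ln ?posrE // divr_gt0.
have lN2 : ln N <= ln 6 *+ n + ln c.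
  by rewrite -lnXn ?ltr0n // addrC -lnM ?posrE // ler_ln ?posrE // mulr_gt0.
have le1 : ln (1 / e) = - ln e by rewrite div1r lnV ?posrE.
have lE1 : - (ln 3 *+ n) <= ln e.
  by rewrite -lnXn ?ltr0n // -lnV ?posrE // ler_ln ?posrE ?invr_gt0.
have lE2 : ln e <= ln 3 - ln 3 *+ n.
  rewrite -lnXn ?ltr0n // -ln_div ?posrE ?ltr0n // ler_ln ?posrE ?divr_gt0 //.
  exact: ltW.
have lE3 : M / eta < - ln e.
  by rewrite ltrNr -[ltRHS]expRK ltr_ln ?posrE ?expR_gt0.
have M0 : 0 < M by rewrite /M; lra.
have le0 : 0 < - ln e by apply: lt_trans lE3; rewrite divr_gt0.
rewrite le1.
have -> : ln N / - ln e - d = (ln N + d * ln e) / - ln e.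
  by field; rewrite ?lt_eqF //; lra.
rewrite normrM [X in _ * X]gtr0_norm ?invr_gt0 // ler_pdivrMr //.
have : M <= eta * - ln e by rewrite mulrC -ler_pdivrMr // ltW.
apply: le_trans.
have dE1 : d * - (ln 3 *+ n) <= d * ln e by rewrite ler_pM2l.
have dE2 : d * ln e <= d * (ln 3 - ln 3 *+ n) by rewrite ler_pM2l.
move: dE1 dE2; rewrite mulrBr mulrN mulrnAr dl /M => dE1 dE2.
by rewrite ler_norml; apply/andP; split; lra.
Qed.

End BoxDimension.
(** Boxes of side [e < 3 * t] that cover the shore, enlarged by [3 * t] on every side, have side at
    most [9 * t] and cover the island. With [2 ^+ n / 6 <= L n] this gives [486 = 81 * 6]. The
    covering of the island by [5 * 3 * 6 ^+ n] boxes gives the upper bound. *)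
Lemma covering_shore (R : realType) (C : nat -> set (R * R)) (A : nat -> seq (R * R))
    (n : nat) (e : R) : cantor_canals C A -> (0 < n)%N ->
  3 ^- n <= e < 3 * 3 ^- n ->
  6 ^+ n / 486 <= ((covering_number (shore C 1) e)%:R : R) <= 486 * 6 ^+ n.
Proof.
move=> hC n0; rewrite -/(land_width R n) => /andP[te et].
set t := land_width R n in te et; have t0 : 0 < t := land_gt0 n.
have p2 : 0 < 2 ^+ n :> R by rewrite exprn_gt0.
have p3 : 0 < 3 ^+ n :> R by rewrite exprn_gt0.
have t3 : t * 3 ^+ n = 1 by rewrite mulVf // gt_eqF.
have e6 : 6 ^+ n = 2 ^+ n * 3 ^+ n :> R by rewrite -exprMn -natrM.
have Lge := length_ge hC n0; have Lle := length_le hC n0.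
have [k ck kL] := strip_coverable t0 (axis_ok hC n0) (axis_size hC n0).
have ck' : coverable (shore C 1) e k.
  apply: coverable_sub te ck; rewrite -(islandE hC n0) (shoreE hC) // => z [_]; exact.
have [cN Nk] := covering_numberP ck'; move: Nk; rewrite -(ler_nat R) => Nk.
set N := covering_number _ _ in cN Nk *.
apply/andP; split; last first.
  apply: le_trans Nk _.
  have : k%:R * t * 3 ^+ n <= 15 * 2 ^+ n * 3 ^+ n by rewrite ler_pM2r //; lra.
  rewrite -mulrA t3 mulr1 e6 => /le_trans; apply.
  by rewrite -mulrA ler_pM2r ?mulr_gt0 //; lra.
have [mI aI] := island_area hC n0.
have cI : coverable (island C n) (9 * t) N.
  apply: (@coverable_sub _ _ (island C n) (e + 6 * t) (9 * t)) => //; first lra.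
  have [c hc] := cN; exists (fun i => ((c i).1 - 3 * t, (c i).2 - 3 * t)).
  move=> z /(near_shore hC n0)[y [y1 y2] /hc[i _ [c1 c2]]]; exists i => //.
  by rewrite -/t in y1 y2; split => /=; lra.
have := coverable_area _ mI cI; rewrite aI lee_fin -/t => /(_ ltac:(lra)) h.
have h1 : axis_length (A n) * t <= (81 * N%:R * t) * t by lra.
rewrite ler_pM2r // in h1.
have h2 : 2 ^+ n / 6 <= 81 * N%:R * t by lra.
have : 2 ^+ n / 6 * 3 ^+ n <= 81 * N%:R * t * 3 ^+ n by rewrite ler_pM2r.
by rewrite -(mulrA _ t) t3 mulr1 e6; lra.
Qed.

Unset Implicit Arguments.

Theorem theorem1p3 (R : realType) (C : nat -> set (R * R)) (A : nat -> seq (R * R))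
    (hC : cantor_canals C A) :
  [/\ shore C 1 = shore C 2, shore C 2 = shore C 3
    & has_box_dim (shore C 1) (ln 6 / ln 3)].
Proof.
split; try by rewrite !(shoreE hC).
apply: (@box_dim_of_bounds R _ 486); first lra.
by move=> n e n0; exact: covering_shore hC n0.
Qed.
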